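(* If $\mathbf{C}$ is a firm monoidal category, then $\mathcal{S}[\mathbf{C}]$ is a tensor-restriction category.
   Context: Notation: in a monoidal category the tensor is $\otimes$, the unit $I$, the coherence isomorphisms $\lambda_A\colon I\otimes A\to A$, $\rho_A\colon A\otimes I\to A$, $\alpha_{A,B,C}\colon A\otimes(B\otimes C)\to(A\otimes B)\otimes C$, braiding (if any) $\sigma_{A,B}\colon A\otimes B\to B\otimes A$; the identity on $A$ is also written $A$. Subunits and firmness. A subunit in a monoidal category is a subobject of $I$ represented by a monomorphism $s\colon S\rightarrowtail I$ such that $s\otimes S$ is invertible. A firm monoidal category is a braided monoidal category in which $s\otimes T\colon S\otimes T\to I\otimes T$ is monic for all subunits $s\colon S\rightarrowtail I$, $t\colon T\rightarrowtail I$. The subunits then form a semilattice under $s\wedge t=\lambda_I\circ(s\otimes t)\colon S\otimes T\rightarrowtail I$. Restriction categories. A restriction category is a category with a choice of $\overline{f}\colon A\to A$ for each $f\colon A\to B$ such that (R1) $f\circ\overline f=f$; (R2) $\overline f\circ\overline g=\overline g\circ\overline f$ if $\mathrm{dom}(f)=\mathrm{dom}(g)$; (R3) $\overline{g\circ\overline f}=\overline g\circ\overline f$ if $\mathrm{dom}(f)=\mathrm{dom}(g)$; (R4) $\overline g\circ f=f\circ\overline{g\circ f}$ if $\mathrm{cod}(f)=\mathrm{dom}(g)$. A restriction idempotent is an endomorphism $e$ with $\overline e=e$. A morphism $f\colon A\to B$ is restriction-total if $\overline f=1_A$. A morphism $f\colon A\to B$ is a restriction isomorphism if there is a (necessarily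 unique) restriction inverse $f^\circ\colon B\to A$ with $f^\circ\circ f=\overline f$ and $f\circ f^\circ=\overline{f^\circ}$. A monoidal restriction category is a monoidal category that is also a restriction category with $\overline{f\otimes g}=\overline f\otimes\overline g$. A firm restriction category is a monoidal restriction category whose underlying monoidal category is firm. The $\mathcal S$-construction. For a firm monoidal category $\mathbf C$, $\mathcal{S}[\mathbf C]$ has the objects of $\mathbf C$; morphisms $A\to B$ are equivalence classes $[s,f]$ of pairs of a subunit $s\colon S\rightarrowtail I$ and a morphism $f\colon A\otimes S\to B$ of $\mathbf C$, where $(s,f)\sim(s',f')$ iff $s'=s\circ m$ and $f'=f\circ(A\otimes m)$ for an isomorphism $m\colon S'\to S$; identities are $[1_I,\rho_A]$; composition of $[s,f]\colon A\to B$ and $[t,g]\colon B\to C$ is $[t,g]\circ[s,f]=[s\wedge t,\ g\circ(f\otimes T)\circ\alpha_{A,S,T}]$. Restriction: $\overline{[s,f]}=[s,\rho_A\circ(A\otimes s)]$. Monoidal structure: unit $I$, tensor of objects as in $\mathbf C$, for $[s,f]\colon A\to B$, $[t,g]\colon C\to D$, $[s,f]\otimes[t,g]=[s\wedge t,\ (f\otimes g)\circ(A\otimes\sigma_{C,S}\otimes T)]$ (associators suppressed), with coherence isomorphisms and braiding induced by those of $\mathbf C$ via $h\mapsto[1_I,h\circ\rho]$. Tensor-restriction. In a monoidal category a morphism $f\colon A\to B$ tensor-restricts to a subunit $s\colon S\rightarrowtail I$ if $f=\rho_B\circ(B\otimes s)\circ h$ for some $h\colon A\to B\otimes S$. It is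 tensor-total if, for every subunit $s$, whenever $f$ tensor-restricts to $s$ then $1_A$ tensor-restricts to $s$. A tensor-restriction point in a firm restriction category is a morphism $d\colon I\to X$ having a restriction inverse $d^\circ\colon X\to I$ that is tensor-total. A scalar is a morphism $I\to I$; for a scalar $e$ and object $X$, $e\bullet X=\lambda_X\circ(e\otimes 1_X)\circ\lambda_X^{-1}\colon X\to X$. A tensor-restriction category is a firm restriction category such that: (TR1) every restriction idempotent scalar $e=\overline e\colon I\to I$ factors as $e=s\circ d$ with $s\colon S\rightarrowtail I$ a subunit and $d\colon I\to S$ a tensor-restriction point; (TR2) for every subunit $s\colon S\rightarrowtail I$ there is a tensor-restriction point $d\colon I\to S$ with $s\circ d=\overline d$; (TR3) every restriction idempotent $f=\overline f\colon X\to X$ equals $e\bullet X$ for a unique restriction idempotent scalar $e=\overline e\colon I\to I$; (TR4) every tensor-total $f\colon X\to Y$ equals $\lceil f\rceil\circ\overline f$ for a unique restriction-total $\lceil f\rceil\colon X\to Y$; (TR5) for every tensor-restriction point $d\colon I\to X$, subunit $s\colon S\rightarrowtail I$, and $f\colon I\to S$, $g\colon X\to I$ with $s\circ f=g\circ d$, there is $m\colon X\to S$ with $f=m\circ d$ and $g=s\circ m$; (TR6) if $d\colon I\to X$ and $d'\colon I\to X'$ are tensor-restriction points, so is $(d\otimes d')\circ\lambda^{-1}\colon I\to X\otimes X'$; (TR7) tensor-restriction points are determined by their codomain: if $d,d'\colon I\to X$ are tensor-restriction points, then $d'=d\circ m$ for a unique scalar $m\colon I\to I$.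
   Formalization: In (TR7), the scalar m with d' = d∘m is unique only among scalars whose restriction equals that of d'; literal uniqueness fails, since for d' = d both the identity of I and the restriction of d satisfy the equation, and they differ whenever the subunit of d is not invertible. *)

(* Defs.v *)
From HB Require Import structures.
From mathcomp Require Import all_boot generic_quotient boolp.

Set Implicit Arguments.
Unset Strict Implicit.
Unset Printing Implicit Defensive.

Declare Scope cat_scope.
Delimit Scope cat_scope with cat.
Local Open Scope quotient_scope.
Local Open Scope cat_scope.

Reserved Notation "g ∘ f" (at level 40, left associativity).
Reserved Notation "A ⊗ B" (at level 39, left associativity).
Reserved Notation "f ⊗₁ g" (at level 39, left associativity).
Reserved Notation "e • X" (at level 38, no associativity).

(* Operations and laws are kept apart: the [*_data] records carry operations
   only and the [is_*] records are propositions about them. *)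

Record category_data := CategoryData {
  Ob :> Type;
  Hom : Ob -> Ob -> Type;
  idm : forall A, Hom A A;
  compose : forall A B C, Hom B C -> Hom A B -> Hom A C
}.

Arguments Hom {c} A B.
Arguments idm {c} A.
Arguments compose {c A B C} g f.
Notation "g ∘ f" := (compose g f) : cat_scope.

Record is_category (C : category_data) : Prop := IsCategory {
  comp_idl : forall (A B : C) (f : Hom A B), idm B ∘ f = f;
  comp_idr : forall (A B : C) (f : Hom A B), f ∘ idm A = f;
  comp_assoc : forall (A B X Y : C) (f : Hom A B) (g : Hom B X) (h : Hom X Y),
    h ∘ (g ∘ f) = (h ∘ g) ∘ f
}.

Definition are_inverse (C : category_data) (A B : C)
    (f : Hom A B) (g : Hom B A) : Prop :=
  g ∘ f = idm A /\ f ∘ g = idm B.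

Definition is_iso (C : category_data) (A B : C) (f : Hom A B) : Prop :=
  exists g : Hom B A, are_inverse f g.

Definition is_monic (C : category_data) (A B : C) (f : Hom A B) : Prop :=
  forall (X : C) (g h : Hom X A), f ∘ g = f ∘ h -> g = h.

Record monoidal_data := MonoidalData {
  mon_cat :> category_data;
  tensor_ob : mon_cat -> mon_cat -> mon_cat;
  tensor : forall A B X Y : mon_cat,
    Hom A B -> Hom X Y -> Hom (tensor_ob A X) (tensor_ob B Y);
  munit : mon_cat;
  lam : forall A, Hom (tensor_ob munit A) A;
  lam_inv : forall A, Hom A (tensor_ob munit A);
  rho : forall A, Hom (tensor_ob A munit) A;
  rho_inv : forall A, Hom A (tensor_ob A munit);
  alpha : forall A B X,
    Hom (tensor_ob A (tensor_ob B X)) (tensor_ob (tensor_ob A B) X);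
  alpha_inv : forall A B X,
    Hom (tensor_ob (tensor_ob A B) X) (tensor_ob A (tensor_ob B X))
}.

Arguments tensor_ob {m} A B.
Arguments tensor {m A B X Y} f g.
Arguments munit m : clear implicits.
Arguments lam {m} A.
Arguments lam_inv {m} A.
Arguments rho {m} A.
Arguments rho_inv {m} A.
Arguments alpha {m} A B X.
Arguments alpha_inv {m} A B X.
Notation "A ⊗ B" := (tensor_ob A B) : cat_scope.
Notation "f ⊗₁ g" := (tensor f g) : cat_scope.

Record is_monoidal (C : monoidal_data) : Prop := IsMonoidal {
  tensor_id : forall A B : C, idm A ⊗₁ idm B = idm (A ⊗ B);
  tensor_comp : forall (A B X A' B' X' : C)
    (f : Hom A B) (g : Hom B X) (f' : Hom A' B') (g' : Hom B' X'),
    (g ∘ f) ⊗₁ (g' ∘ f') = (g ⊗₁ g') ∘ (f ⊗₁ f');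
  lam_iso : forall A : C, are_inverse (lam A) (lam_inv A);
  rho_iso : forall A : C, are_inverse (rho A) (rho_inv A);
  alpha_iso : forall A B X : C, are_inverse (alpha A B X) (alpha_inv A B X);
  lam_nat : forall (A B : C) (f : Hom A B),
    f ∘ lam A = lam B ∘ (idm (munit C) ⊗₁ f);
  rho_nat : forall (A B : C) (f : Hom A B),
    f ∘ rho A = rho B ∘ (f ⊗₁ idm (munit C));
  alpha_nat : forall (A B X A' B' X' : C)
    (f : Hom A A') (g : Hom B B') (h : Hom X X'),
    ((f ⊗₁ g) ⊗₁ h) ∘ alpha A B X = alpha A' B' X' ∘ (f ⊗₁ (g ⊗₁ h));
  triangle : forall A B : C,
    (rho A ⊗₁ idm B) ∘ alpha A (munit C) B = idm A ⊗₁ lam B;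
  pentagon : forall A B X Y : C,
    alpha (A ⊗ B) X Y ∘ alpha A B (X ⊗ Y) =
    (alpha A B X ⊗₁ idm Y) ∘ alpha A (B ⊗ X) Y ∘ (idm A ⊗₁ alpha B X Y)
}.

Record braided_data := BraidedData {
  braided_mon :> monoidal_data;
  sigma : forall A B : braided_mon, Hom (A ⊗ B) (B ⊗ A);
  sigma_inv : forall A B : braided_mon, Hom (B ⊗ A) (A ⊗ B)
}.

Arguments sigma {b} A B.
Arguments sigma_inv {b} A B.

Record is_braided (C : braided_data) : Prop := IsBraided {
  sigma_iso : forall A B : C, are_inverse (sigma A B) (sigma_inv A B);
  sigma_nat : forall (A B A' B' : C) (f : Hom A A') (g : Hom B B'),
    (g ⊗₁ f) ∘ sigma A B = sigma A' B' ∘ (f ⊗₁ g);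
  hexagon1 : forall A B X : C,
    alpha_inv B X A ∘ sigma A (B ⊗ X) ∘ alpha_inv A B X =
    (idm B ⊗₁ sigma A X) ∘ alpha_inv B A X ∘ (sigma A B ⊗₁ idm X);
  hexagon2 : forall A B X : C,
    alpha X A B ∘ sigma (A ⊗ B) X ∘ alpha A B X =
    (sigma A X ⊗₁ idm B) ∘ alpha A X B ∘ (idm A ⊗₁ sigma B X)
}.

(* Representatives of subunits, as subobjects of the unit; every notion below
   is invariant under replacing a representative by an isomorphic one. *)
Definition is_subunit (C : monoidal_data) (S : C) (s : Hom S (munit C)) : Prop :=
  is_monic s /\ is_iso (s ⊗₁ idm S).

Definition meet (C : monoidal_data) (S T : C)
    (s : Hom S (munit C)) (t : Hom T (munit C)) : Hom (S ⊗ T) (munit C) :=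
  lam (munit C) ∘ (s ⊗₁ t).

Record is_firm_monoidal (C : braided_data) : Prop := IsFirmMonoidal {
  firm_category : is_category C;
  firm_is_monoidal : is_monoidal C;
  firm_braided : is_braided C;
  firm_monic : forall (S T : C) (s : Hom S (munit C)) (t : Hom T (munit C)),
    is_subunit s -> is_subunit t -> is_monic (s ⊗₁ idm T)
}.

Record firm_monoidal_category := FirmMonoidalCategory {
  firm_data :> braided_data;
  firm_laws : is_firm_monoidal firm_data
}.

Record restriction_data := RestrictionData {
  restr_braided :> braided_data;
  restr : forall A B : restr_braided, Hom A B -> Hom A A
}.

Arguments restr {r A B} f.

Record is_restriction (C : restriction_data) : Prop := IsRestriction {
  restr_R1 : forall (A B : C) (f : Hom A B), f ∘ restr f = f;
  restr_R2 : forall (A B X : C) (f : Hom A B) (g : Hom A X),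
    restr f ∘ restr g = restr g ∘ restr f;
  restr_R3 : forall (A B X : C) (f : Hom A B) (g : Hom A X),
    restr (g ∘ restr f) = restr g ∘ restr f;
  restr_R4 : forall (A B X : C) (f : Hom A B) (g : Hom B X),
    restr g ∘ f = f ∘ restr (g ∘ f)
}.

Record is_firm_restriction (C : restriction_data) : Prop := IsFirmRestriction {
  firm_restr_firm : is_firm_monoidal C;
  firm_restr_restr : is_restriction C;
  firm_restr_tensor : forall (A B X Y : C) (f : Hom A B) (g : Hom X Y),
    restr (f ⊗₁ g) = restr f ⊗₁ restr g
}.

Definition is_restriction_idempotent (C : restriction_data) (A : C)
    (e : Hom A A) : Prop := restr e = e.

Definition is_restriction_total (C : restriction_data) (A B : C)
    (f : Hom A B) : Prop := restr f = idm A.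

Definition is_restriction_inverse (C : restriction_data) (A B : C)
    (f : Hom A B) (f' : Hom B A) : Prop :=
  f' ∘ f = restr f /\ f ∘ f' = restr f'.

Definition tensor_restricts (C : monoidal_data) (A B : C) (f : Hom A B)
    (S : C) (s : Hom S (munit C)) : Prop :=
  exists h : Hom A (B ⊗ S), f = rho B ∘ (idm B ⊗₁ s) ∘ h.

Definition is_tensor_total (C : monoidal_data) (A B : C) (f : Hom A B) : Prop :=
  forall (S : C) (s : Hom S (munit C)), is_subunit s ->
    tensor_restricts f s -> tensor_restricts (idm A) s.

Definition is_tensor_restriction_point (C : restriction_data) (X : C)
    (d : Hom (munit C) X) : Prop :=
  exists d' : Hom X (munit C), is_restriction_inverse d d' /\ is_tensor_total d'.

Definition scalar (C : monoidal_data) : Type := Hom (munit C) (munit C).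

Definition scalar_mul (C : monoidal_data) (e : scalar C) (X : C) : Hom X X :=
  lam X ∘ (e ⊗₁ idm X) ∘ lam_inv X.

Notation "e • X" := (scalar_mul e X) : cat_scope.

(* In [TR7] the uniqueness of [m] is uniqueness among the scalars with the same
   restriction as [d'] (equivalently, uniqueness of [m ∘ restr d']).  Without
   that proviso the clause for [d' = d] would identify the scalars [idm] and
   [restr d], since [d ∘ idm _ = d = d ∘ restr d] by (R1). *)
Record is_tensor_restriction_category (C : restriction_data) : Prop :=
  IsTensorRestrictionCategory {
  tensor_restr_firm : is_firm_restriction C;
  TR1 : forall e : scalar C, is_restriction_idempotent e ->
    exists (S : C) (s : Hom S (munit C)) (d : Hom (munit C) S),
      [/\ is_subunit s, is_tensor_restriction_point d & e = s ∘ d];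
  TR2 : forall (S : C) (s : Hom S (munit C)), is_subunit s ->
    exists d : Hom (munit C) S,
      is_tensor_restriction_point d /\ s ∘ d = restr d;
  TR3 : forall (X : C) (f : Hom X X), is_restriction_idempotent f ->
    exists! e : scalar C, is_restriction_idempotent e /\ f = e • X;
  TR4 : forall (X Y : C) (f : Hom X Y), is_tensor_total f ->
    exists! f' : Hom X Y, is_restriction_total f' /\ f = f' ∘ restr f;
  TR5 : forall (X : C) (d : Hom (munit C) X) (S : C) (s : Hom S (munit C))
      (f : Hom (munit C) S) (g : Hom X (munit C)),
    is_tensor_restriction_point d -> is_subunit s -> s ∘ f = g ∘ d ->
    exists m : Hom X S, f = m ∘ d /\ g = s ∘ m;
  TR6 : forall (X X' : C) (d : Hom (munit C) X) (d' : Hom (munit C) X'),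
    is_tensor_restriction_point d -> is_tensor_restriction_point d' ->
    is_tensor_restriction_point ((d ⊗₁ d') ∘ lam_inv (munit C));
  TR7 : forall (X : C) (d d' : Hom (munit C) X),
    is_tensor_restriction_point d -> is_tensor_restriction_point d' ->
    exists! m : scalar C, restr m = restr d' /\ d' = d ∘ m
}.

Section FirmFacts.
Variable C : firm_monoidal_category.
Implicit Types A B X S T : C.
Local Notation I := (munit C).

Let cat : is_category C := firm_category (firm_laws C).
Let mon : is_monoidal C := firm_is_monoidal (firm_laws C).
Let br : is_braided C := firm_braided (firm_laws C).

Lemma idm_iso A : is_iso (idm A).
Proof. by exists (idm A); split; rewrite (comp_idl cat). Qed.

Lemma iso_comp A B X (g : Hom B X) (f : Hom A B) :
  is_iso g -> is_iso f -> is_iso (g ∘ f).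
Proof.
move=> [g' [g'g gg']] [f' [f'f ff']]; exists (f' ∘ g'); split.
  rewrite (comp_assoc cat) -(comp_assoc cat g g' f') g'g.
  by rewrite (comp_idr cat).
rewrite (comp_assoc cat) -(comp_assoc cat f' f g) ff'.
by rewrite (comp_idr cat).
Qed.

Lemma iso_tensor A B X Y (f : Hom A B) (g : @Hom C X Y) :
  is_iso f -> is_iso g -> is_iso (f ⊗₁ g).
Proof.
move=> [f' [f'f ff']] [g' [g'g gg']]; exists (f' ⊗₁ g').
by split; rewrite -(tensor_comp mon) ?f'f ?g'g ?ff' ?gg' (tensor_id mon).
Qed.

Lemma idm_subunit : is_subunit (idm I).
Proof.
split; last by rewrite (tensor_id mon); exact: idm_iso.
by move=> X g h; rewrite !(comp_idl cat).
Qed.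

Definition middle A B S T : Hom ((A ⊗ B) ⊗ (S ⊗ T)) ((A ⊗ S) ⊗ (B ⊗ T)) :=
  alpha A S (B ⊗ T)
  ∘ (idm A ⊗₁ (alpha_inv S B T ∘ (sigma B S ⊗₁ idm T) ∘ alpha B S T))
  ∘ alpha_inv A B (S ⊗ T).

Lemma alpha_inv_nat (A B X A' B' X' : C)
    (f : Hom A A') (g : Hom B B') (h : Hom X X') :
  (f ⊗₁ (g ⊗₁ h)) ∘ alpha_inv A B X = alpha_inv A' B' X' ∘ ((f ⊗₁ g) ⊗₁ h).
Proof.
have [aK _] := alpha_iso mon A' B' X'; have [_ Ka] := alpha_iso mon A B X.
rewrite -[LHS](comp_idl cat) -aK -!(comp_assoc cat).
by rewrite (comp_assoc cat _ _ (alpha _ _ _)) -(alpha_nat mon)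
   -(comp_assoc cat) Ka (comp_idr cat).
Qed.

Lemma middle_nat (A B S T A' B' S' T' : C) (f : Hom A A') (g : Hom B B')
    (h : Hom S S') (k : Hom T T') :
  ((f ⊗₁ h) ⊗₁ (g ⊗₁ k)) ∘ middle A B S T =
  middle A' B' S' T' ∘ ((f ⊗₁ g) ⊗₁ (h ⊗₁ k)).
Proof.
rewrite /middle !(comp_assoc cat) (alpha_nat mon) -!(comp_assoc cat).
congr (_ ∘ _); rewrite -alpha_inv_nat !(comp_assoc cat); congr (_ ∘ _).
rewrite -!(tensor_comp mon) (comp_idl cat) (comp_idr cat); congr (_ ⊗₁ _).
rewrite !(comp_assoc cat) alpha_inv_nat -!(comp_assoc cat); congr (_ ∘ _).
rewrite -(alpha_nat mon) !(comp_assoc cat); congr (_ ∘ _).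
by rewrite -!(tensor_comp mon) (sigma_nat br) (comp_idl cat) (comp_idr cat).
Qed.

Lemma middle_iso A B S T : is_iso (middle A B S T).
Proof.
have inv_iso (Y Z : C) (f : Hom Y Z) g : are_inverse f g -> is_iso f /\ is_iso g.
  by move=> [fK Kf]; split; [exists g|exists f].
have [a1 _] := inv_iso _ _ _ _ (alpha_iso mon A S (B ⊗ T)).
have [_ a2] := inv_iso _ _ _ _ (alpha_iso mon A B (S ⊗ T)).
have [_ a3] := inv_iso _ _ _ _ (alpha_iso mon S B T).
have [a4 _] := inv_iso _ _ _ _ (alpha_iso mon B S T).
have [s1 _] := inv_iso _ _ _ _ (sigma_iso br B S).
apply: iso_comp => //; apply: iso_comp => //; apply: iso_tensor.
  exact: idm_iso.
apply: iso_comp => //; apply: iso_comp => //.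
by apply: iso_tensor => //; exact: idm_iso.
Qed.

Lemma meet_subunit S T (s : Hom S I) (t : Hom T I) :
  is_subunit s -> is_subunit t -> is_subunit (meet s t).
Proof.
move=> sS sT; split.
  have [lTK _] := lam_iso mon T.
  have -> : meet s t = t ∘ (lam T ∘ (s ⊗₁ idm T)).
    rewrite (comp_assoc cat) (lam_nat mon) -(comp_assoc cat).
    by rewrite -(tensor_comp mon) (comp_idl cat) (comp_idr cat).
  move=> X g h; rewrite -!(comp_assoc cat) => /(proj1 sT).
  move=> /(congr1 (fun x => lam_inv T ∘ x)).
  by rewrite !(comp_assoc cat) lTK (comp_idl cat) => /(firm_monic (firm_laws C) sS sT).
have -> : meet s t ⊗₁ idm (S ⊗ T)
        = (lam I ⊗₁ idm (S ⊗ T)) ∘ ((s ⊗₁ t) ⊗₁ (idm S ⊗₁ idm T)).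
  by rewrite -(tensor_comp mon) (tensor_id mon) (comp_idl cat).
apply: iso_comp.
  apply: iso_tensor; last exact: idm_iso.
  by have [lK Kl] := lam_iso mon I; exists (lam_inv I).
have [n [nK Kn]] := middle_iso I I S T.
have -> : (s ⊗₁ t) ⊗₁ (idm S ⊗₁ idm T)
   = n ∘ (((s ⊗₁ idm S) ⊗₁ (t ⊗₁ idm T)) ∘ middle S T S T).
  by rewrite middle_nat (comp_assoc cat) nK (comp_idl cat).
apply: iso_comp; first by exists (middle I I S T).
apply: iso_comp; last exact: middle_iso.
by apply: iso_tensor; [case: sS|case: sT].
Qed.

End FirmFacts.

Record spair (C : firm_monoidal_category) (A B : C) := SPair {
  sp_ob : C;
  sp_sub : Hom sp_ob (munit C);
  sp_mor : Hom (A ⊗ sp_ob) B;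
  sp_subunit : is_subunit sp_sub
}.

Definition spair_equiv (C : firm_monoidal_category) (A B : C)
    (p q : spair A B) : Prop :=
  exists m : Hom (sp_ob q) (sp_ob p),
    [/\ is_iso m, sp_sub q = sp_sub p ∘ m
      & sp_mor q = sp_mor p ∘ (idm A ⊗₁ m)].

Section SHom.
Variables (C : firm_monoidal_category) (A B : C).
Let cat : is_category C := firm_category (firm_laws C).
Let mon : is_monoidal C := firm_is_monoidal (firm_laws C).

HB.instance Definition _ := gen_eqMixin (spair A B).
HB.instance Definition _ := gen_choiceMixin (spair A B).

Lemma spair_equiv_refl (p : spair A B) : spair_equiv p p.
Proof.
exists (idm _); split; first exact: idm_iso.
  by rewrite (comp_idr cat).
by rewrite (tensor_id mon) (comp_idr cat).
Qed.

Lemma spair_equiv_sym (p q : spair A B) : spair_equiv p q -> spair_equiv q p.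
Proof.
move=> [m [[n [nm mn]] es ef]]; exists n; split; first by exists m.
  by rewrite es -(comp_assoc cat) mn (comp_idr cat).
rewrite ef -(comp_assoc cat) -(tensor_comp mon) mn (comp_idl cat).
by rewrite (tensor_id mon) (comp_idr cat).
Qed.

Lemma spair_equiv_trans (p q r : spair A B) :
  spair_equiv p q -> spair_equiv q r -> spair_equiv p r.
Proof.
move=> [m [im es ef]] [n [jn et eg]]; exists (m ∘ n); split.
- exact: iso_comp.
- by rewrite et es (comp_assoc cat).
- by rewrite eg ef -(comp_assoc cat) -(tensor_comp mon) (comp_idl cat).
Qed.

Definition spair_eqv : rel (spair A B) := fun p q => `[< spair_equiv p q >].

Lemma spair_eqv_refl : reflexive spair_eqv.
Proof. by move=> p; apply/asboolP/spair_equiv_refl. Qed.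

Lemma spair_eqv_sym : symmetric spair_eqv.
Proof. by move=> p q; apply/asboolP/asboolP; apply: spair_equiv_sym. Qed.

Lemma spair_eqv_trans : transitive spair_eqv.
Proof.
by move=> q p r /asboolP pq /asboolP qr; apply/asboolP/(spair_equiv_trans pq).
Qed.

Canonical spair_eqv_rel :=
  EquivRel spair_eqv spair_eqv_refl spair_eqv_sym spair_eqv_trans.

Definition SHom : Type := {eq_quot spair_eqv}.

Definition sclass (p : spair A B) : SHom := (\pi_({eq_quot spair_eqv}) p)%qT.
Definition srepr (x : SHom) : spair A B := repr (x : {eq_quot spair_eqv}).

Lemma sreprK (x : SHom) : sclass (srepr x) = x.
Proof. exact: (@reprK _ {eq_quot spair_eqv}). Qed.

Lemma sclassP (p q : spair A B) : sclass p = sclass q <-> spair_equiv p q.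
Proof.
by split=> [/eqmodP/asboolP|pq] //; apply/eqmodP/asboolP.
Qed.

Lemma srepr_class (p : spair A B) : spair_equiv (srepr (sclass p)) p.
Proof. by apply/sclassP; rewrite sreprK. Qed.

End SHom.

Section SConstruction.
Variable C : firm_monoidal_category.
Implicit Types A B X Y : C.
Local Notation I := (munit C).
Let cat : is_category C := firm_category (firm_laws C).
Let mon : is_monoidal C := firm_is_monoidal (firm_laws C).

Definition spair_embed A B (h : Hom A B) : spair A B :=
  SPair (h ∘ rho A) (idm_subunit C).

Definition spair_comp A B X (q : spair B X) (p : spair A B) : spair A X :=
  SPair (sp_mor q ∘ (sp_mor p ⊗₁ idm (sp_ob q)) ∘ alpha A (sp_ob p) (sp_ob q))
        (meet_subunit (sp_subunit p) (sp_subunit q)).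

Definition spair_restr A B (p : spair A B) : spair A A :=
  SPair (rho A ∘ (idm A ⊗₁ sp_sub p)) (sp_subunit p).

Definition spair_tensor A B X Y (p : spair A B) (q : spair X Y) :
    spair (A ⊗ X) (B ⊗ Y) :=
  SPair ((sp_mor p ⊗₁ sp_mor q) ∘ middle A X (sp_ob p) (sp_ob q))
        (meet_subunit (sp_subunit p) (sp_subunit q)).

Definition Sembed A B (h : Hom A B) : SHom A B := sclass (spair_embed h).

(* The operations on classes are computed on chosen representatives; lemmas
   [Scomp_class], [Srestr_class] and [Stensor_class] show that the choice is
   immaterial. *)
Definition Scomp A B X (y : SHom B X) (x : SHom A B) : SHom A X :=
  sclass (spair_comp (srepr y) (srepr x)).

Definition Srestr A B (x : SHom A B) : SHom A A :=
  sclass (spair_restr (srepr x)).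

Definition Stensor A B X Y (x : SHom A B) (y : SHom X Y) :
    SHom (A ⊗ X) (B ⊗ Y) :=
  sclass (spair_tensor (srepr x) (srepr y)).

Lemma meet_comp (S T S' T' : C) (s : Hom S I) (t : Hom T I)
    (m : Hom S' S) (n : Hom T' T) :
  meet (s ∘ m) (t ∘ n) = meet s t ∘ (m ⊗₁ n).
Proof. by rewrite /meet (tensor_comp mon) (comp_assoc cat). Qed.

Lemma Scomp_class A B X (q : spair B X) (p : spair A B) :
  Scomp (sclass q) (sclass p) = sclass (spair_comp q p).
Proof.
apply/sclassP; have [m [im es ef]] := srepr_class p.
have [n [jn et eg]] := srepr_class q.
exists (m ⊗₁ n); split; first exact: iso_tensor.
  by rewrite /= es et meet_comp.
rewrite /= ef eg -!(comp_assoc cat) -(alpha_nat mon); congr (_ ∘ _).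
rewrite !(comp_assoc cat); congr (_ ∘ _).
by rewrite -!(tensor_comp mon) !(comp_idl cat) (comp_idr cat).
Qed.

Lemma Srestr_class A B (p : spair A B) :
  Srestr (sclass p) = sclass (spair_restr p).
Proof.
apply/sclassP; have [m [im es ef]] := srepr_class p.
exists m; split=> //=.
by rewrite es -(comp_assoc cat) -(tensor_comp mon) (comp_idl cat).
Qed.

Lemma Stensor_class A B X Y (p : spair A B) (q : spair X Y) :
  Stensor (sclass p) (sclass q) = sclass (spair_tensor p q).
Proof.
apply/sclassP; have [m [im es ef]] := srepr_class p.
have [n [jn et eg]] := srepr_class q.
exists (m ⊗₁ n); split; first exact: iso_tensor.
  by rewrite /= es et meet_comp.
rewrite /= ef eg (tensor_comp mon) -[LHS](comp_assoc cat) middle_nat.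
by rewrite (tensor_id mon) (comp_assoc cat).
Qed.

Definition S_category : category_data :=
  @CategoryData (Ob C) (@SHom C) (fun A => Sembed (idm A)) Scomp.

Definition S_monoidal : monoidal_data :=
  @MonoidalData S_category
    (@tensor_ob C) Stensor I
    (fun A => Sembed (lam A)) (fun A => Sembed (lam_inv A))
    (fun A => Sembed (rho A)) (fun A => Sembed (rho_inv A))
    (fun A B X => Sembed (alpha A B X)) (fun A B X => Sembed (alpha_inv A B X)).

Definition S_braided : braided_data :=
  @BraidedData S_monoidal
    (fun A B => Sembed (sigma A B)) (fun A B => Sembed (sigma_inv A B)).

Definition S_construction : restriction_data :=
  @RestrictionData S_braided Srestr.

End SConstruction.

Arguments S_construction C : clear implicits.

(* Main.v *)
From mathcomp Require Import ssreflect ssrfun.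
Require Import Defs.

Set Implicit Arguments.
Unset Strict Implicit.
Unset Printing Implicit Defensive.
Local Open Scope cat_scope.

(** For a subunit [s : S >-> I] write [erase A s : A ⊗ S -> A]. The functor
    [- ⊗ S] is an idempotent comonad with counit [erase], so two maps out of an
    object of the form [A ⊗ S] agree as soon as they agree after a map [e] with
    [e ⊗ S] invertible. All the coherence equations of [S[C]] follow: after
    erasing the subunits, both sides become the same [erase].

    Morphisms of [S[C]] with a left inverse come from [C], hence the subunits of
    [S[C]] are those of [C]. A morphism [[s, f]] tensor-restricts to [s], so it
    can be tensor-total only if its domain [A] satisfies [A ≅ A ⊗ S]. It follows
    that the tensor-restriction points are exactly the [[s, f]] with [f]
    invertible, and the axioms (TR1)-(TR7) become computations with such
    pairs. *)

Section SConstruction.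
Variable C : firm_monoidal_category.
Implicit Types A B X Y S T U : C.
Local Notation I := (munit C).

Let cat : is_category C := firm_category (firm_laws C).
Let mon : is_monoidal C := firm_is_monoidal (firm_laws C).
Let br : is_braided C := firm_braided (firm_laws C).
Local Notation compA := (comp_assoc cat).
Local Notation idl := (comp_idl cat).
Local Notation idr := (comp_idr cat).
Local Notation tensor1 := (tensor_id mon).
Local Notation tensorC := (tensor_comp mon).
Local Notation id1S := (idm_subunit C).

(** Composites are kept nested to the right, so an equation for [g ∘ f] has to fire in front of an
    arbitrary tail [k]. *)
Lemma comp_eql A B X Y (f : Hom A B) (g : Hom B X) (h : Hom A X) :
  g ∘ f = h -> forall k : Hom Y A, g ∘ (f ∘ k) = h ∘ k.
Proof. by move=> <- k; rewrite compA. Qed.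

(** * Isomorphisms and coherence laws of [C] *)

Lemma iso_monic A B X (e : Hom A B) (f g : Hom X A) :
  is_iso e -> e ∘ f = e ∘ g -> f = g.
Proof.
move=> [e' [e'e _]] /(congr1 (fun x => e' ∘ x)).
by rewrite !compA e'e !idl.
Qed.

Lemma iso_epic A B X (e : Hom A B) (f g : Hom B X) :
  is_iso e -> f ∘ e = g ∘ e -> f = g.
Proof.
move=> [e' [_ ee']] /(congr1 (fun x => x ∘ e')).
by rewrite -!compA ee' !idr.
Qed.

Lemma iso_invl A B (f : Hom A B) (g : Hom B A) : are_inverse f g -> is_iso f.
Proof. by move=> fg; exists g. Qed.

Lemma iso_invr A B (f : Hom A B) (g : Hom B A) : are_inverse f g -> is_iso g.
Proof. by move=> [gf fg]; exists f. Qed.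

Lemma lamI A : is_iso (lam A).
Proof. exact: iso_invl (lam_iso mon A). Qed.

Lemma lam_invI A : is_iso (lam_inv A).
Proof. exact: iso_invr (lam_iso mon A). Qed.

Lemma rhoI A : is_iso (rho A).
Proof. exact: iso_invl (rho_iso mon A). Qed.

Lemma rho_invI A : is_iso (rho_inv A).
Proof. exact: iso_invr (rho_iso mon A). Qed.

Lemma alphaI A B X : is_iso (alpha A B X).
Proof. exact: iso_invl (alpha_iso mon A B X). Qed.

Lemma alpha_invI A B X : is_iso (alpha_inv A B X).
Proof. exact: iso_invr (alpha_iso mon A B X). Qed.

Lemma sigmaI A B : is_iso (sigma A B).
Proof. exact: iso_invl (sigma_iso br A B). Qed.

Lemma alpha_invK A B X : alpha A B X ∘ alpha_inv A B X = idm _.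
Proof. by have [] := alpha_iso mon A B X. Qed.

Lemma tensor_idl_inj A B (f g : Hom A B) : idm I ⊗₁ f = idm I ⊗₁ g -> f = g.
Proof.
move=> e; apply: (iso_epic (lamI A)).
by rewrite !(lam_nat mon) e.
Qed.

Lemma tensor_idr_inj A B (f g : Hom A B) : f ⊗₁ idm I = g ⊗₁ idm I -> f = g.
Proof.
move=> e; apply: (iso_epic (rhoI A)).
by rewrite !(rho_nat mon) e.
Qed.

Lemma tensor_compl A B X Y (f : Hom A B) (g : Hom B X) :
  (g ∘ f) ⊗₁ idm Y = (g ⊗₁ idm Y) ∘ (f ⊗₁ idm Y).
Proof. by rewrite -tensorC idl. Qed.

Lemma tensor_compr A B X Y (f : Hom A B) (g : Hom B X) :
  idm Y ⊗₁ (g ∘ f) = (idm Y ⊗₁ g) ∘ (idm Y ⊗₁ f).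
Proof. by rewrite -tensorC idl. Qed.

Lemma tensor_splitl A B X Y (f : Hom A B) (g : Hom X Y) :
  (idm B ⊗₁ g) ∘ (f ⊗₁ idm X) = f ⊗₁ g.
Proof. by rewrite -tensorC idl idr. Qed.

Lemma tensor_splitr A B X Y (f : Hom A B) (g : Hom X Y) :
  (f ⊗₁ idm Y) ∘ (idm A ⊗₁ g) = f ⊗₁ g.
Proof. by rewrite -tensorC idl idr. Qed.

(* Kelly: the next three coherence laws follow from the triangle and the
   pentagon because [I ⊗ -] and [- ⊗ I] are faithful. *)
Lemma lam_tensor A B : (lam A ⊗₁ idm B) ∘ alpha I A B = lam (A ⊗ B).
Proof.
apply: tensor_idl_inj; apply: (iso_monic (alphaI I A B)).
rewrite -(triangle mon I (A ⊗ B)) -tensor1 compA -(alpha_nat mon) -compA.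
rewrite (pentagon mon) -!compA tensor_compr.
rewrite (comp_eql (esym (alpha_nat mon _ _ _))) -compA.
rewrite (comp_eql (esym (tensor_compl _ _ _))).
by rewrite (triangle mon).
Qed.

Lemma rho_tensor A B : rho (A ⊗ B) ∘ alpha A B I = idm A ⊗₁ rho B.
Proof.
apply: tensor_idr_inj.
have e1 := iso_tensor (idm_iso A) (alphaI B I I).
apply: (iso_epic (iso_comp (alphaI A (B ⊗ I) I) e1)).
rewrite tensor_compl -!compA [alpha _ _ _ ⊗₁ _ ∘ _]compA.
rewrite -(pentagon mon) !compA (triangle mon) -tensor1 (alpha_nat mon).
by rewrite (alpha_nat mon) -!compA -tensor_compr (triangle mon).
Qed.

Lemma lam_unit : lam I = rho I.
Proof.
apply: tensor_idr_inj; apply: (iso_epic (alphaI I I I)).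
rewrite (triangle mon) lam_tensor.
by apply: (iso_monic (lamI I)); rewrite (lam_nat mon).
Qed.

Lemma lam_tensor_inv A B : lam (A ⊗ B) ∘ alpha_inv I A B = lam A ⊗₁ idm B.
Proof. by rewrite -lam_tensor -compA alpha_invK idr. Qed.

Lemma rho_tensor_inv A B :
  (idm A ⊗₁ rho B) ∘ alpha_inv A B I = rho (A ⊗ B).
Proof. by rewrite -rho_tensor -compA alpha_invK idr. Qed.

Lemma triangle_inv A B :
  (idm A ⊗₁ lam B) ∘ alpha_inv A I B = rho A ⊗₁ idm B.
Proof. by rewrite -(triangle mon) -compA alpha_invK idr. Qed.

(** After tensoring with [I], naturality of the braiding and the unit laws reduce this to the first
    hexagon with two of its objects equal to [I]. *)
Lemma lam_sigma A : lam A ∘ sigma A I = rho A.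
Proof.
apply/esym/tensor_idr_inj; apply: (iso_monic (sigmaI A I)).
rewrite -triangle_inv compA -(sigma_nat br) -lam_tensor_inv.
rewrite -!compA [alpha_inv _ _ _ ∘ _]compA (hexagon1 br) -compA.
rewrite (comp_eql (esym (lam_nat mon _))) -compA.
by rewrite (comp_eql (lam_tensor_inv _ _)) -tensor_compl.
Qed.

(* [middle] and [erase] are locked because rewriting with associativity would
   otherwise unfold these composites. *)
Definition shuffle A B S T : Hom ((A ⊗ B) ⊗ (S ⊗ T)) ((A ⊗ S) ⊗ (B ⊗ T)) :=
  locked (middle A B S T).

Lemma shuffleE A B S T : shuffle A B S T = middle A B S T.
Proof. by rewrite /shuffle -lock. Qed.

Lemma shuffle_nat A B S T A' B' S' T' (f : Hom A A') (g : Hom B B')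
    (h : Hom S S') (k : Hom T T') :
  ((f ⊗₁ h) ⊗₁ (g ⊗₁ k)) ∘ shuffle A B S T =
  shuffle A' B' S' T' ∘ ((f ⊗₁ g) ⊗₁ (h ⊗₁ k)).
Proof. by rewrite !shuffleE middle_nat. Qed.

Lemma shuffle_iso A B S T : is_iso (shuffle A B S T).
Proof. by rewrite shuffleE; exact: middle_iso. Qed.

(** The case of trivial subunits, to which [erase_shuffle] reduces by naturality; [lam_sigma]
    absorbs the braiding inside [middle]. *)
Lemma shuffle_unit A B :
  (rho A ⊗₁ rho B) ∘ shuffle A B I I = rho (A ⊗ B) ∘ (idm (A ⊗ B) ⊗₁ lam I).
Proof.
rewrite shuffleE /middle -tensor_splitl -!compA.
rewrite (comp_eql (triangle mon _ _)) !(comp_eql (esym (tensor_compr _ _ _))).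
rewrite -!compA.
rewrite (comp_eql (lam_tensor_inv _ _)) (comp_eql (esym (tensor_compl _ _ _))).
rewrite lam_sigma (triangle mon) !tensor_compr -compA (alpha_inv_nat (C := C)).
by rewrite compA rho_tensor_inv tensor1.
Qed.

(** * Erasing subunits *)

Definition erase A S (s : Hom S I) : Hom (A ⊗ S) A :=
  locked (rho A ∘ (idm A ⊗₁ s)).

Lemma eraseE A S (s : Hom S I) : erase A s = rho A ∘ (idm A ⊗₁ s).
Proof. by rewrite /erase -lock. Qed.

Definition erase_left S (s : Hom S I) A : Hom (S ⊗ A) A := lam A ∘ (s ⊗₁ idm A).

Lemma erase_nat A B S (s : Hom S I) (f : Hom A B) :
  f ∘ erase A s = erase B s ∘ (f ⊗₁ idm S).
Proof.
by rewrite !eraseE compA (rho_nat mon) -!compA tensor_splitl tensor_splitr.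
Qed.

Lemma erase_comp A S T (s : Hom S I) (m : Hom T S) :
  erase A (s ∘ m) = erase A s ∘ (idm A ⊗₁ m).
Proof. by rewrite !eraseE tensor_compr compA. Qed.

Lemma erase_id A : erase A (idm I) = rho A.
Proof. by rewrite !eraseE tensor1 idr. Qed.

Lemma erase_unit S (s : Hom S I) : erase I s = s ∘ lam S.
Proof. by rewrite eraseE (lam_nat mon) lam_unit. Qed.

Lemma erase_tensor A B S (s : Hom S I) :
  erase (A ⊗ B) s ∘ alpha A B S = idm A ⊗₁ erase B s.
Proof.
rewrite !eraseE -compA -tensor1 (alpha_nat mon) compA rho_tensor.
by rewrite -tensor_compr.
Qed.

(** With [erase_shuffle], this gives normal forms: structure maps followed by erasures collapse to a
    single [erase], so parallel coherence maps become comparable. *)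
Lemma erase_alpha A S T (s : Hom S I) (t : Hom T I) :
  erase A s ∘ (erase (A ⊗ S) t ∘ alpha A S T) = erase A (meet s t).
Proof.
rewrite erase_tensor !eraseE /meet -compA -tensor_compr; congr (_ ∘ (_ ⊗₁ _)).
by rewrite compA (rho_nat mon) -compA tensor_splitr lam_unit.
Qed.

Lemma erase_shuffle A B S T (s : Hom S I) (t : Hom T I) :
  (erase A s ⊗₁ erase B t) ∘ shuffle A B S T = erase (A ⊗ B) (meet s t).
Proof.
rewrite !eraseE tensorC -compA shuffle_nat compA shuffle_unit.
by rewrite -compA tensor1 -tensor_compr.
Qed.

(** The triangle absorbs the middle unit on either side. Precomposition with a restriction thereby
    becomes an action on the subunit alone. *)
Lemma erase_leftE S T (s : Hom S I) A :
  (erase A s ⊗₁ idm T) ∘ alpha A S T = idm A ⊗₁ erase_left s T.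
Proof.
rewrite eraseE tensor_compl -compA (alpha_nat mon) compA (triangle mon).
by rewrite -tensor_compr.
Qed.

Lemma meet_erase S T (s : Hom S I) (t : Hom T I) : meet s t = s ∘ erase S t.
Proof.
by rewrite eraseE compA (rho_nat mon) -compA tensor_splitr -lam_unit.
Qed.

Lemma meet_erase_left S T (s : Hom S I) (t : Hom T I) :
  meet s t = t ∘ erase_left s T.
Proof. by rewrite /erase_left compA (lam_nat mon) -compA tensor_splitl. Qed.

Lemma meet_alpha S T U (s : Hom S I) (t : Hom T I) (u : Hom U I) :
  meet s (meet t u) = meet (meet s t) u ∘ alpha S T U.
Proof.
have e : meet s t ⊗₁ u = (lam I ⊗₁ idm I) ∘ ((s ⊗₁ t) ⊗₁ u).
  by rewrite -tensorC idl.
rewrite {3}/meet e -!compA (alpha_nat mon) (comp_eql (lam_tensor _ _)) compA.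
by rewrite (lam_nat mon) -compA -tensorC idl.
Qed.

Lemma meet_sigma S T (s : Hom S I) (t : Hom T I) :
  meet s t = meet t s ∘ sigma S T.
Proof.
by rewrite /meet -compA (sigma_nat br) compA lam_sigma lam_unit.
Qed.

Lemma meet_shuffle S T S' T' (s : Hom S I) (t : Hom T I) (s' : Hom S' I)
    (t' : Hom T' I) :
  meet (meet s s') (meet t t') =
  meet (meet s t) (meet s' t') ∘ shuffle S S' T T'.
Proof.
rewrite (meet_erase s t) (meet_erase s' t') (meet_comp (C := C)) -compA.
by rewrite erase_shuffle -meet_erase.
Qed.

(** * Cancellation on objects supported in a subunit *)

(** Invertibility after restriction to [U]. Erasures of subunits above [U] have it without being
    invertible themselves, and it is stable under composition and tensor. *)
Definition local_iso U A B (e : Hom A B) : Prop := is_iso (e ⊗₁ idm U).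

Lemma local_iso_of_iso U A B (e : Hom A B) : is_iso e -> local_iso U e.
Proof. by move=> ie; apply: iso_tensor => //; exact: idm_iso. Qed.

Lemma local_iso_comp U A B X (e : Hom A B) (e' : Hom B X) :
  local_iso U e' -> local_iso U e -> local_iso U (e' ∘ e).
Proof. by move=> *; rewrite /local_iso tensor_compl; apply: iso_comp. Qed.

Lemma local_iso_idl U A B X (e : Hom A B) :
  local_iso U e -> local_iso U (idm X ⊗₁ e).
Proof.
move=> ie; rewrite /local_iso; have -> : (idm X ⊗₁ e) ⊗₁ idm U =
    alpha X B U ∘ (idm X ⊗₁ (e ⊗₁ idm U)) ∘ alpha_inv X A U.
  by rewrite -(alpha_nat mon) -compA alpha_invK idr.
apply: iso_comp (alpha_invI _ _ _); apply: iso_comp (alphaI _ _ _) _.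
by apply: iso_tensor => //; exact: idm_iso.
Qed.

(** Conjugation with the braiding reduces this to [local_iso_idl]. *)
Lemma local_iso_idr U A B X (e : Hom A B) :
  local_iso U e -> local_iso U (e ⊗₁ idm X).
Proof.
move=> ie; have [_ Ks] := sigma_iso br X A.
have -> : e ⊗₁ idm X = sigma X B ∘ (idm X ⊗₁ e) ∘ sigma_inv X A.
  by rewrite -(sigma_nat br) -compA Ks idr.
apply: local_iso_comp; last exact/local_iso_of_iso/iso_invr/(sigma_iso br).
apply: local_iso_comp; last exact: local_iso_idl.
exact/local_iso_of_iso/sigmaI.
Qed.

Lemma local_iso_tensor U A B X Y (e : Hom A B) (e' : Hom X Y) :
  local_iso U e -> local_iso U e' -> local_iso U (e ⊗₁ e').
Proof.
move=> ie ie'; rewrite -tensor_splitl; apply: local_iso_comp.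
  exact: local_iso_idl.
exact: local_iso_idr.
Qed.

Definition sub_le S T (s : Hom S I) (t : Hom T I) : Prop :=
  exists m : Hom S T, s = t ∘ m.

Lemma sub_le_refl S (s : Hom S I) : sub_le s s.
Proof. by exists (idm S); rewrite idr. Qed.

Lemma sub_le_trans S T U (s : Hom S I) (t : Hom T I) (u : Hom U I) :
  sub_le s t -> sub_le t u -> sub_le s u.
Proof. by move=> [m ->] [n ->]; exists (n ∘ m); rewrite compA. Qed.

Lemma meet_le_l S T (s : Hom S I) (t : Hom T I) : sub_le (meet s t) s.
Proof. by exists (erase S t); exact: meet_erase. Qed.

Lemma meet_le_r S T (s : Hom S I) (t : Hom T I) : sub_le (meet s t) t.
Proof. by exists (erase_left s T); exact: meet_erase_left. Qed.

(* A factorisation [u = s ∘ m] makes [s ⊗ U] split epic, since [u ⊗ U] is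
   invertible; firmness makes it monic. *)
Lemma local_iso_sub S U (s : Hom S I) (u : Hom U I) :
  is_subunit s -> is_subunit u -> sub_le u s -> local_iso U s.
Proof.
move=> sS uS [m um]; have [k [ku uk]] := proj2 uS.
exists ((m ⊗₁ idm U) ∘ k).
have r : (s ⊗₁ idm U) ∘ ((m ⊗₁ idm U) ∘ k) = idm _.
  by rewrite compA -tensor_compl -um.
split=> //; apply: (firm_monic (firm_laws C) sS uS).
by rewrite compA r idl idr.
Qed.

Lemma local_iso_erase A S U (s : Hom S I) (u : Hom U I) :
  is_subunit s -> is_subunit u -> sub_le u s -> local_iso U (erase A s).
Proof.
rewrite eraseE.
move=> sS uS us; apply: local_iso_comp.
  exact/local_iso_of_iso/rhoI.
exact/local_iso_idl/(local_iso_sub sS uS us).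
Qed.

(** A coalgebra structure reduced to its counit law: this is what tensor-restriction of the identity
    provides, and [erase_iso] upgrades the section to an inverse. *)
Definition supported A S (s : Hom S I) : Prop :=
  exists h : Hom A (A ⊗ S), erase A s ∘ h = idm A.

(** Since [e ⊗ S] is monic, [f ⊗ S = g ⊗ S]; naturality of [erase] recovers [f] from [f ⊗ S] by
    precomposing with the section [h]. *)
Lemma supported_cancel A B X S (s : Hom S I) (e : Hom B X) (f g : Hom A B) :
  supported A s -> local_iso S e -> e ∘ f = e ∘ g -> f = g.
Proof.
move=> [h hK] ie efg.
have fgS : f ⊗₁ idm S = g ⊗₁ idm S.
  by apply: (iso_monic ie); rewrite -!tensor_compl efg.
by rewrite -[f]idr -[g]idr -hK (compA h _ f) (compA h _ g) !erase_nat fgS.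
Qed.

Lemma supported_tensor A B S (s : Hom S I) :
  supported B s -> supported (A ⊗ B) s.
Proof.
move=> [h hK]; exists (alpha A B S ∘ (idm A ⊗₁ h)).
by rewrite compA erase_tensor -tensor_compr hK tensor1.
Qed.

Lemma supported_iso A B S (s : Hom S I) (f : Hom A B) :
  is_iso f -> supported A s -> supported B s.
Proof.
move=> [f' [f'f ff']] [h hK]; exists ((f ⊗₁ idm S) ∘ h ∘ f').
by rewrite -compA (comp_eql (esym (erase_nat _ _))) -compA (comp_eql hK) idl.
Qed.

Lemma supported_le A S T (s : Hom S I) (t : Hom T I) :
  sub_le s t -> supported A s -> supported A t.
Proof.
move=> [m ->] [h]; rewrite erase_comp -compA => hK.
by exists ((idm A ⊗₁ m) ∘ h).
Qed.

(** Being a subunit makes [s ⊗ S] invertible; the braiding turns this into invertibility of [S ⊗ s],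
    hence of [erase S s]. *)
Lemma supported_self S (s : Hom S I) : is_subunit s -> supported S s.
Proof.
move=> [_ is_]; have [k [_ kK]] : is_iso (erase S s).
  rewrite eraseE; apply: iso_comp (rhoI S) _.
  have [_ Kt] := sigma_iso br S S.
  have -> : idm S ⊗₁ s = sigma I S ∘ (s ⊗₁ idm S) ∘ sigma_inv S S.
    by rewrite -(sigma_nat br) -compA Kt idr.
  apply: iso_comp; last exact/iso_invr/(sigma_iso br).
  exact: iso_comp (sigmaI _ _) is_.
by exists k.
Qed.

Lemma supportedA A S (s : Hom S I) : is_subunit s -> supported (A ⊗ S) s.
Proof. by move=> sS; apply/supported_tensor/supported_self. Qed.

(** The given section is also a left inverse, because [erase A s] can be cancelled after itself on
    the supported object [A ⊗ S]. *)
Lemma erase_iso A S (s : Hom S I) :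
  is_subunit s -> supported A s -> is_iso (erase A s).
Proof.
move=> sS /[dup] sA [h hK]; exists h; split=> //.
apply: (supported_cancel (supportedA A sS)).
  exact: local_iso_erase (sub_le_refl s).
by rewrite compA hK idl idr.
Qed.

Lemma erase_self_iso S (s : Hom S I) : is_subunit s -> is_iso (erase S s).
Proof. by move=> sS; apply/erase_iso/supported_self. Qed.

(** The section [h] gives [s = meet s t ∘ h], and the meet lies below [t]. *)
Lemma supported_sub S T (s : Hom S I) (t : Hom T I) :
  supported S t -> sub_le s t.
Proof.
move=> [h hK]; exists (erase_left s T ∘ h).
by rewrite compA -meet_erase_left meet_erase -compA hK idr.
Qed.

(** Self-support supplies a diagonal [h : U -> U ⊗ U] along which the two factorisations are
    paired. *)
Lemma sub_le_meet S T U (s : Hom S I) (t : Hom T I) (u : Hom U I) :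
  is_subunit u -> sub_le u s -> sub_le u t -> sub_le u (meet s t).
Proof.
move=> uS [m um] [n un]; have [h hK] := supported_self uS.
exists ((m ⊗₁ n) ∘ h); rewrite compA -(meet_comp (C := C)) -um -un.
by rewrite meet_erase -compA hK idr.
Qed.

Lemma sub_le_iso S T (s : Hom S I) (t : Hom T I) (m : Hom T S) :
  is_subunit s -> is_subunit t -> sub_le s t -> t = s ∘ m -> is_iso m.
Proof.
move=> [sm _] [tm _] [n sn] tsm; exists n; split.
  by apply: tm; rewrite compA -sn -tsm idr.
by apply: sm; rewrite compA -tsm -sn idr.
Qed.

(** * The category S[C] *)

Definition Sclass A B S (s : Hom S I) (sS : is_subunit s)
  (f : Hom (A ⊗ S) B) : SHom A B := sclass (SPair f sS).

Lemma SHom_ind A B (P : SHom A B -> Prop) :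
  (forall S (s : Hom S I) (sS : is_subunit s) f, P (Sclass sS f)) ->
  forall x, P x.
Proof.
by move=> H x; rewrite -[x]sreprK; case: (srepr x) => S s f sS; apply: H.
Qed.

(** Invertibility of the comparison map is deduced here from the converse inequality;
    [Sclass_eq_iso] takes it as given. *)
Lemma Sclass_eq A B S T (s : Hom S I) (t : Hom T I) (sS : is_subunit s)
    (tS : is_subunit t) (f : Hom (A ⊗ S) B) (g : Hom (A ⊗ T) B) (m : Hom T S) :
  sub_le s t -> t = s ∘ m -> g = f ∘ (idm A ⊗₁ m) -> Sclass sS f = Sclass tS g.
Proof.
move=> st tsm gfm; apply/sclassP; exists m; split=> //.
exact: sub_le_iso st tsm.
Qed.

Arguments Sclass_eq {A B S T s t sS tS f g m}.

Lemma Sclass_eq_iso A B S T (s : Hom S I) (t : Hom T I) (sS : is_subunit s)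
    (tS : is_subunit t) (f : Hom (A ⊗ S) B) (g : Hom (A ⊗ T) B) (m : Hom T S) :
  is_iso m -> t = s ∘ m -> g = f ∘ (idm A ⊗₁ m) -> Sclass sS f = Sclass tS g.
Proof. by move=> mI tsm gfm; apply/sclassP; exists m. Qed.

Arguments Sclass_eq_iso {A B S T s t sS tS f g m}.

(** Since [s] is monic, the comparison map behind an equality of classes is unique, so any known
    factorisation of [t] may serve. *)
Lemma Sclass_eqE A B S T (s : Hom S I) (t : Hom T I) (sS : is_subunit s)
    (tS : is_subunit t) (f : Hom (A ⊗ S) B) (g : Hom (A ⊗ T) B) (m : Hom T S) :
  Sclass sS f = Sclass tS g -> t = s ∘ m -> g = f ∘ (idm A ⊗₁ m).
Proof.
move=> /sclassP[/= n [_ tsn ->]] tsm; congr (_ ∘ (_ ⊗₁ _)).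
by apply: (proj1 sS); rewrite -tsn.
Qed.

Lemma Sclass_eq_le A B S T (s : Hom S I) (t : Hom T I) (sS : is_subunit s)
    (tS : is_subunit t) (f : Hom (A ⊗ S) B) (g : Hom (A ⊗ T) B) :
  Sclass sS f = Sclass tS g -> sub_le s t /\ sub_le t s.
Proof.
move=> e; split; last by case/sclassP: e => n [_ tsn _]; exists n.
by case/esym/sclassP: e => n [_ tsn _]; exists n.
Qed.

Lemma Sclass_inj A B S (s : Hom S I) (sS sS' : is_subunit s)
    (f g : Hom (A ⊗ S) B) :
  Sclass sS f = Sclass sS' g -> f = g.
Proof.
move=> e; have := Sclass_eqE e (esym (idr s)).
by rewrite tensor1 idr.
Qed.

Lemma Sclass_sub A B S T (s : Hom S I) (t : Hom T I) (sS : is_subunit s)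
    (tS : is_subunit t) (f : Hom (A ⊗ S) B) :
  sub_le s t -> sub_le t s ->
  exists2 m : Hom T S, is_iso m & Sclass sS f = Sclass tS (f ∘ (idm A ⊗₁ m)).
Proof.
move=> st [m tsm]; exists m; last exact: Sclass_eq st tsm _.
exact: sub_le_iso st tsm.
Qed.

Lemma SembedE A B (f : Hom A B) : Sembed f = Sclass id1S (f ∘ rho A).
Proof. by []. Qed.

Lemma Scomp_Sclass A B X S T (s : Hom S I) (t : Hom T I) (sS : is_subunit s)
    (tS : is_subunit t) (f : Hom (A ⊗ S) B) (g : Hom (B ⊗ T) X) :
  Scomp (Sclass tS g) (Sclass sS f) =
  Sclass (meet_subunit sS tS) (g ∘ (f ⊗₁ idm T) ∘ alpha A S T).
Proof. exact: Scomp_class. Qed.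

Lemma Stensor_Sclass A B X Y S T (s : Hom S I) (t : Hom T I)
    (sS : is_subunit s) (tS : is_subunit t)
    (f : Hom (A ⊗ S) B) (g : Hom (X ⊗ T) Y) :
  Stensor (Sclass sS f) (Sclass tS g) =
  Sclass (meet_subunit sS tS) ((f ⊗₁ g) ∘ shuffle A X S T).
Proof. by rewrite shuffleE; exact: Stensor_class. Qed.

Lemma Srestr_Sclass A B S (s : Hom S I) (sS : is_subunit s)
    (f : Hom (A ⊗ S) B) :
  Srestr (Sclass sS f) = Sclass sS (erase A s).
Proof. by rewrite eraseE; exact: Srestr_class. Qed.

Lemma meet_unitr S (s : Hom S I) : meet s (idm I) = s ∘ rho S.
Proof. by rewrite meet_erase erase_id. Qed.

Lemma meet_unitl S (s : Hom S I) : meet (idm I) s = s ∘ lam S.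
Proof. by rewrite /meet (lam_nat mon). Qed.

Lemma Sembed_compl A B X S (s : Hom S I) (sS : is_subunit s)
    (f : Hom (A ⊗ S) B) (h : Hom B X) :
  Scomp (Sembed h) (Sclass sS f) = Sclass sS (h ∘ f).
Proof.
rewrite SembedE Scomp_Sclass.
apply: esym; apply: (Sclass_eq_iso (m := rho S)).
- exact: rhoI.
- exact: meet_unitr.
- by rewrite -[h ∘ _ ∘ _]compA -(rho_nat mon) -!compA rho_tensor.
Qed.

Lemma Sembed_compr A B X S (s : Hom S I) (sS : is_subunit s)
    (f : Hom (B ⊗ S) X) (h : Hom A B) :
  Scomp (Sclass sS f) (Sembed h) = Sclass sS (f ∘ (h ⊗₁ idm S)).
Proof.
rewrite SembedE Scomp_Sclass.
apply: esym; apply: (Sclass_eq_iso (m := lam S)).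
- exact: lamI.
- exact: meet_unitl.
- by rewrite tensor_compl -!compA (triangle mon).
Qed.

Lemma Sembed_comp A B X (g : Hom B X) (f : Hom A B) :
  Scomp (Sembed g) (Sembed f) = Sembed (g ∘ f).
Proof. by rewrite [Sembed f]SembedE Sembed_compl compA. Qed.

Lemma Sembed_inj A B (f g : Hom A B) : Sembed f = Sembed g -> f = g.
Proof. by move=> /Sclass_inj; apply: iso_epic (rhoI A). Qed.

Lemma Stensor_embedl A B X Y S (s : Hom S I) (sS : is_subunit s)
    (f : Hom A B) (g : Hom (X ⊗ S) Y) :
  Stensor (Sembed f) (Sclass sS g) = Sclass sS ((f ⊗₁ g) ∘ alpha_inv A X S).
Proof.
rewrite SembedE Stensor_Sclass.
apply: esym; apply: (Sclass_eq_iso (m := lam S)).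
- exact: lamI.
- exact: meet_unitl.
rewrite -[g in LHS]idr tensorC -!compA; congr (_ ∘ _).
(* After erasing [s], both sides become [erase (A ⊗ X) (meet (idm I) s)]. *)
apply: (supported_cancel (s := s) (e := idm A ⊗₁ erase X s)).
- apply: supported_tensor; apply: supported_tensor; exact: supported_self.
- exact/local_iso_idl/local_iso_erase/sub_le_refl.
rewrite compA tensor_splitl -erase_id erase_shuffle.
rewrite compA -erase_tensor -[_ ∘ _ ∘ alpha_inv _ _ _]compA alpha_invK idr.
by rewrite -erase_comp meet_unitl.
Qed.

Lemma Sembed_tensor A B X Y (f : Hom A B) (g : Hom X Y) :
  Stensor (Sembed f) (Sembed g) = Sembed (f ⊗₁ g).
Proof.
rewrite [Sembed g]SembedE Stensor_embedl -{1}[f]idr tensorC -compA.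
by rewrite rho_tensor_inv.
Qed.

(** * Category, monoidal and braiding laws of [S[C]] *)

Lemma Scomp_id_l A B (x : SHom A B) : Scomp (Sembed (idm B)) x = x.
Proof. by elim/SHom_ind: x => S s sS f; rewrite Sembed_compl idl. Qed.

Lemma Scomp_id_r A B (x : SHom A B) : Scomp x (Sembed (idm A)) = x.
Proof. by elim/SHom_ind: x => S s sS f; rewrite Sembed_compr tensor1 idr. Qed.

Lemma Scomp_assoc A B X Y (x : SHom A B) (y : SHom B X) (z : SHom X Y) :
  Scomp z (Scomp y x) = Scomp (Scomp z y) x.
Proof.
elim/SHom_ind: x => S s sS f; elim/SHom_ind: y => T t tS g.
elim/SHom_ind: z => U u uS h; rewrite !Scomp_Sclass.
apply: (Sclass_eq_iso (m := alpha S T U)).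
- exact: alphaI.
- exact: meet_alpha.
rewrite -!compA; congr (_ ∘ _); rewrite !tensor_compl -!compA; congr (_ ∘ _).
rewrite -tensor1 (comp_eql (esym (alpha_nat mon _ _ _))) -compA.
by rewrite (pentagon mon) -compA.
Qed.


Lemma Stensor_comp A B X A' B' X' (f : SHom A B) (g : SHom B X)
    (f' : SHom A' B') (g' : SHom B' X') :
  Stensor (Scomp g f) (Scomp g' f') = Scomp (Stensor g g') (Stensor f f').
Proof.
elim/SHom_ind: f => S s sS f; elim/SHom_ind: g => T t tS g.
elim/SHom_ind: f' => S' s' sS' f'; elim/SHom_ind: g' => T' t' tS' g'.
rewrite (Scomp_Sclass sS tS) (Scomp_Sclass sS' tS') (Stensor_Sclass sS sS').
rewrite (Stensor_Sclass tS tS') Stensor_Sclass Scomp_Sclass.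
set u := meet (meet s s') (meet t t').
have uS : is_subunit u by do 2!apply: meet_subunit.
have us : sub_le u s := sub_le_trans (meet_le_l _ _) (meet_le_l _ _).
have us' : sub_le u s' := sub_le_trans (meet_le_l _ _) (meet_le_r _ _).
have ut : sub_le u t := sub_le_trans (meet_le_r _ _) (meet_le_l _ _).
have ut' : sub_le u t' := sub_le_trans (meet_le_r _ _) (meet_le_r _ _).
apply: (Sclass_eq_iso (m := shuffle S S' T T')).
- exact: shuffle_iso.
- exact: meet_shuffle.
rewrite !tensorC tensor_compl -!compA; congr (_ ∘ _).
rewrite -(tensor1 T T') (comp_eql (esym (shuffle_nat _ _ _ _))) tensor1 -!compA.
congr (_ ∘ _).
(* [e] erases all four subunits, after which both sides equal [erase (A ⊗ A') u]. *)
pose e := (erase A s ∘ erase (A ⊗ S) t) ⊗₁ (erase A' s' ∘ erase (A' ⊗ S') t').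
apply: (supported_cancel (s := u) (e := e)); first exact: supportedA.
  apply: local_iso_tensor; apply: local_iso_comp;
    exact: (local_iso_erase _ _ uS).
have -> : e ∘ (shuffle (A ⊗ S) (A' ⊗ S') T T'
    ∘ (shuffle A A' S S' ⊗₁ idm (T ⊗ T')
    ∘ alpha (A ⊗ A') (S ⊗ S') (T ⊗ T'))) = erase (A ⊗ A') u.
  rewrite /e tensorC -compA (comp_eql (erase_shuffle _ _ _ _)).
  rewrite (comp_eql (esym (erase_nat _ _))) -compA.
  by rewrite (comp_eql (erase_shuffle _ _ _ _)) erase_alpha.
rewrite (comp_eql (esym (tensorC _ _ _ _))) -!compA !erase_alpha.
by rewrite (comp_eql (erase_shuffle _ _ _ _)) -erase_comp -meet_shuffle.
Qed.

Lemma Sembed_inverse A B (f : Hom A B) (g : Hom B A) :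
  are_inverse f g -> @are_inverse (S_category C) A B (Sembed f) (Sembed g).
Proof.
by move=> [gf fg]; split; rewrite /= Sembed_comp ?gf ?fg.
Qed.

Lemma Sembed_iso A B (f : Hom A B) :
  is_iso f -> @is_iso (S_category C) A B (Sembed f).
Proof. by move=> [g fg]; exists (Sembed g); exact: Sembed_inverse. Qed.

Lemma Slam_nat A B (f : SHom A B) :
  Scomp f (Sembed (lam A)) =
  Scomp (Sembed (lam B)) (Stensor (Sembed (idm I)) f).
Proof.
elim/SHom_ind: f => S s sS f.
rewrite Stensor_embedl Sembed_compl Sembed_compr; congr Sclass.
by rewrite compA -(lam_nat mon) -compA lam_tensor_inv.
Qed.

(** On this side the subunit has to move past the unit, which requires a cancellation; [Slam_nat]
    follows directly from [Stensor_embedl]. *)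
Lemma Srho_nat A B (f : SHom A B) :
  Scomp f (Sembed (rho A)) =
  Scomp (Sembed (rho B)) (Stensor f (Sembed (idm I))).
Proof.
elim/SHom_ind: f => S s sS f; rewrite Sembed_compr.
rewrite [Sembed (idm I)]SembedE idl Stensor_Sclass Sembed_compl.
apply: (Sclass_eq_iso (m := rho S)); [exact: rhoI|exact: meet_unitr|].
rewrite -[f ⊗₁ _]tensor_splitr -!compA.
rewrite (comp_eql (esym (rho_nat mon _))) -!compA; congr (_ ∘ _).
apply: (supported_cancel (s := s) (e := erase A s)).
- apply: supported_tensor.
  exact: (supported_iso (rho_invI S) (supported_self sS)).
- exact/local_iso_erase/sub_le_refl.
rewrite (comp_eql (rho_nat mon _)) -compA (comp_eql (tensor_splitr _ _)).
rewrite -(erase_id I) erase_shuffle compA -erase_nat -compA -erase_comp.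
by rewrite meet_unitr.
Qed.

Lemma Salpha_nat A B X A' B' X' (f : SHom A A') (g : SHom B B')
    (h : SHom X X') :
  Scomp (Stensor (Stensor f g) h) (Sembed (alpha A B X)) =
  Scomp (Sembed (alpha A' B' X')) (Stensor f (Stensor g h)).
Proof.
elim/SHom_ind: f => S s sS f; elim/SHom_ind: g => T t tS g.
elim/SHom_ind: h => U u uS h.
rewrite (Stensor_Sclass sS tS) (Stensor_Sclass tS uS) !Stensor_Sclass.
rewrite Sembed_compl Sembed_compr.
have vS := meet_subunit sS (meet_subunit tS uS).
have vs : sub_le (meet s (meet t u)) s := meet_le_l _ _.
have vt : sub_le (meet s (meet t u)) t :=
  sub_le_trans (meet_le_r _ _) (meet_le_l _ _).
have vu : sub_le (meet s (meet t u)) u :=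
  sub_le_trans (meet_le_r _ _) (meet_le_r _ _).
apply: (Sclass_eq_iso (m := alpha S T U)); [exact: alphaI|exact: meet_alpha|].
rewrite -[h in LHS]idr -[f in LHS]idr -[h in RHS]idr !tensorC -!compA.
rewrite (comp_eql (esym (alpha_nat mon _ _ _))) -!compA.
congr (_ ∘ _); first by rewrite idr.
(* [e] erases the three subunits; both sides become [alpha A B X] after the erasure of
   [meet s (meet t u)]. *)
pose e := (erase A s ⊗₁ erase B t) ⊗₁ erase X u.
apply: (supported_cancel (s := meet s (meet t u)) (e := e)).
- exact: supportedA.
- apply: local_iso_tensor; last exact: (local_iso_erase _ _ vS).
  by apply: local_iso_tensor; exact: (local_iso_erase _ _ vS).
rewrite /e (comp_eql (alpha_nat mon _ _ _)) -compA.
rewrite (comp_eql (esym (tensorC _ _ _ _))) idr erase_shuffle erase_shuffle.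
rewrite (comp_eql (esym (tensorC _ _ _ _))) idr erase_shuffle.
rewrite (comp_eql (erase_shuffle _ _ _ _)) (comp_eql (esym (erase_nat _ _))).
by rewrite -compA -erase_comp -meet_alpha.
Qed.

Lemma S_is_monoidal : is_monoidal (S_monoidal C).
Proof.
split=> /=.
- by move=> A B; rewrite Sembed_tensor tensor1.
- by move=> A B X A' B' X' f g f' g'; exact: Stensor_comp.
- by move=> A; apply/Sembed_inverse/(lam_iso mon).
- by move=> A; apply/Sembed_inverse/(rho_iso mon).
- by move=> A B X; apply/Sembed_inverse/(alpha_iso mon).
- by move=> A B f; exact: Slam_nat.
- by move=> A B f; exact: Srho_nat.
- by move=> A B X A' B' X' f g h; exact: Salpha_nat.
- by move=> A B; rewrite !Sembed_tensor Sembed_comp (triangle mon).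
- by move=> A B X Y; rewrite !Sembed_tensor !Sembed_comp (pentagon mon).
Qed.

Lemma Ssigma_nat A B A' B' (f : SHom A A') (g : SHom B B') :
  Scomp (Stensor g f) (Sembed (sigma A B)) =
  Scomp (Sembed (sigma A' B')) (Stensor f g).
Proof.
elim/SHom_ind: f => S s sS f; elim/SHom_ind: g => T t tS g.
rewrite !Stensor_Sclass Sembed_compl Sembed_compr.
have vS := meet_subunit sS tS.
apply: (Sclass_eq_iso (m := sigma S T)); [exact: sigmaI|exact: meet_sigma|].
rewrite compA -(sigma_nat br) -!compA; congr (_ ∘ _).
apply: (supported_cancel (s := meet s t) (e := erase B t ⊗₁ erase A s)).
- exact: supportedA.
- by apply: local_iso_tensor; apply: (local_iso_erase _ _ vS) => //;
    [exact: meet_le_r|exact: meet_le_l].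
rewrite compA (sigma_nat br) -compA erase_shuffle.
rewrite (comp_eql (erase_shuffle _ _ _ _)) (comp_eql (esym (erase_nat _ _))).
by rewrite -compA -erase_comp -meet_sigma.
Qed.

Lemma S_is_braided : is_braided (S_braided C).
Proof.
split=> /=.
- by move=> A B; apply/Sembed_inverse/(sigma_iso br).
- by move=> A B A' B' f g; exact: Ssigma_nat.
- by move=> A B X; rewrite !Sembed_tensor !Sembed_comp (hexagon1 br).
- by move=> A B X; rewrite !Sembed_tensor !Sembed_comp (hexagon2 br).
Qed.

(** * Monomorphisms and subunits of [S[C]] *)

Lemma Sembed_monic A B (f : Hom A B) :
  is_monic f -> @is_monic (S_category C) A B (Sembed f).
Proof.
move=> fm X; elim/SHom_ind=> T t tS g; elim/SHom_ind=> U u uS h /=.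
rewrite !Sembed_compl => e.
have [tu [m um]] := Sclass_eq_le e.
apply: (Sclass_eq tu um); apply: fm.
by rewrite compA; exact: Sclass_eqE e um.
Qed.

(** As [meet s t = s ∘ erase S t], the monic [s] is also split epic. *)
Lemma meet_iso_l S T (s : Hom S I) (t : Hom T I) :
  is_subunit s -> is_iso (meet s t) -> is_iso s.
Proof.
move=> [sm _]; rewrite meet_erase => -[n [_ sn]]; exists (erase S t ∘ n).
have sn1 : s ∘ (erase S t ∘ n) = idm I by rewrite compA.
by split=> //; apply: sm; rewrite compA sn1 idl idr.
Qed.

Lemma Sclass_total A B S (s : Hom S I) (sS : is_subunit s)
    (f : Hom (A ⊗ S) B) (h : Hom A B) :
  Sclass sS f = Sembed h -> is_iso s.
Proof.
move=> /Sclass_eq_le[_ [n sn]]; exists n; split=> //.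
by apply: (proj1 sS); rewrite compA -sn idl idr.
Qed.

Lemma Sclass_embed A B S (s : Hom S I) (sS : is_subunit s)
    (f : Hom (A ⊗ S) B) :
  is_iso s -> exists h : Hom A B, Sclass sS f = Sembed h.
Proof.
move=> [n [ns sn]]; exists (f ∘ (idm A ⊗₁ n) ∘ rho_inv A).
apply: (Sclass_eq_iso (m := n)); [by exists s|by []|].
by rewrite -compA (proj1 (rho_iso mon A)) idr.
Qed.

(** The composite lives over [meet s t], which is invertible because the identity lives over [I];
    hence [s] is invertible and can be absorbed into the map. *)
Lemma Sembed_of_split A B (x : SHom A B) (y : SHom B A) :
  Scomp y x = Sembed (idm A) -> exists h : Hom A B, x = Sembed h.
Proof.
elim/SHom_ind: x => S s sS f; elim/SHom_ind: y => T t tS g.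
rewrite Scomp_Sclass => /Sclass_total /(meet_iso_l sS).
exact: Sclass_embed.
Qed.

Lemma S_subunitP S (x : SHom S I) :
  @is_subunit (S_monoidal C) S x <->
  exists2 s : Hom S I, is_subunit s & x = Sembed s.
Proof.
split=> [[xm [y [/= yx xy]]]|[s sS ->]].
  (* Tensoring with an identity keeps the subunit of [x] up to a unit factor, so [x] comes from [C]
     because the split monic [x ⊗ S] does. *)
  have [s xs] : exists s, x = Sembed s.
    move: (Sembed_of_split yx) => {y yx xy xm}.
    elim/SHom_ind: x => U u uS f [h].
    rewrite [Sembed (idm S)]SembedE Stensor_Sclass => /Sclass_total.
    by move=> /(meet_iso_l uS); exact: Sclass_embed.
  exists s => //; move: xm yx xy; rewrite {}xs Sembed_tensor => sm yx xy.
  have [z yz] := Sembed_of_split xy.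
  move: yx xy; rewrite {}yz !Sembed_comp => /Sembed_inj zs /Sembed_inj sz.
  split; last by exists z.
  move=> X g h e; apply: Sembed_inj; apply: sm => /=.
  by rewrite !Sembed_comp e.
split; last by rewrite /= Sembed_tensor; apply: Sembed_iso; case: sS.
by apply: Sembed_monic; case: sS.
Qed.

Lemma S_is_firm_monoidal : is_firm_monoidal (S_braided C).
Proof.
split; [|exact: S_is_monoidal|exact: S_is_braided|].
  by split; [exact: Scomp_id_l|exact: Scomp_id_r|exact: Scomp_assoc].
move=> S T x y /S_subunitP[s sS ->] /S_subunitP[t tS _] /=.
rewrite Sembed_tensor; apply: Sembed_monic.
exact: (firm_monic (firm_laws C) sS tS).
Qed.

(** * The restriction structure of [S[C]] *)

Lemma Serase_eq A S T (s : Hom S I) (t : Hom T I) (sS : is_subunit s)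
    (tS : is_subunit t) :
  sub_le s t -> sub_le t s -> Sclass sS (erase A s) = Sclass tS (erase A t).
Proof.
by move=> st [m tsm]; apply: (Sclass_eq st tsm); rewrite tsm erase_comp.
Qed.

Lemma Scomp_erase_r A B S T (s : Hom S I) (t : Hom T I) (sS : is_subunit s)
    (tS : is_subunit t) (f : Hom (A ⊗ T) B) :
  Scomp (Sclass tS f) (Sclass sS (erase A s)) =
  Sclass (meet_subunit sS tS) (f ∘ (idm A ⊗₁ erase_left s T)).
Proof. by rewrite Scomp_Sclass -compA erase_leftE. Qed.

Lemma Scomp_erase A S T (s : Hom S I) (t : Hom T I) (sS : is_subunit s)
    (tS : is_subunit t) :
  Scomp (Sclass tS (erase A t)) (Sclass sS (erase A s)) =
  Sclass (meet_subunit sS tS) (erase A (meet s t)).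
Proof. by rewrite Scomp_erase_r -erase_comp -meet_erase_left. Qed.

Lemma S_is_restriction : is_restriction (S_construction C).
Proof.
split=> /=.
- move=> A B; elim/SHom_ind=> S s sS f; rewrite Srestr_Sclass Scomp_erase_r.
  apply: esym; apply: (Sclass_eq (m := erase_left s S)) => //.
    exact: sub_le_meet (sub_le_refl s) (sub_le_refl s).
  exact: meet_erase_left.
- move=> A B X; elim/SHom_ind=> S s sS f; elim/SHom_ind=> T t tS g.
  rewrite !Srestr_Sclass !Scomp_erase.
  apply: Serase_eq; apply: sub_le_meet (meet_le_r _ _) (meet_le_l _ _);
    exact: meet_subunit.
- move=> A B X; elim/SHom_ind=> S s sS f; elim/SHom_ind=> T t tS g.
  rewrite (Srestr_Sclass sS f) (Srestr_Sclass tS g) Scomp_erase Scomp_erase_r.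
  exact: Srestr_Sclass.
- move=> A B X; elim/SHom_ind=> S s sS f; elim/SHom_ind=> T t tS g.
  rewrite (Srestr_Sclass tS g) (Scomp_Sclass sS tS f g) Srestr_Sclass.
  rewrite Scomp_Sclass Scomp_erase_r.
  (* For (R4), the right side lives over [meet u s], where the last copy of [s] is redundant and
     gets erased. The remaining equation between maps into [S] is tested against the monic [s]. *)
  set u := meet s t; have uS : is_subunit u by exact: meet_subunit.
  apply: (Sclass_eq (m := erase (S ⊗ T) s)).
  - exact: sub_le_meet (sub_le_refl _) (meet_le_l _ _).
  - exact: meet_erase.
  rewrite -erase_nat -!compA; congr (_ ∘ _).
  rewrite (comp_eql (erase_tensor _ _ _)) -tensor_compr; congr (_ ⊗₁ _).
  apply: (proj1 sS).
  by rewrite -meet_erase_left compA -meet_erase -meet_erase.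
Qed.

Lemma S_is_firm_restriction : is_firm_restriction (S_construction C).
Proof.
split; [exact: S_is_firm_monoidal|exact: S_is_restriction|].
move=> A B X Y; elim/SHom_ind=> S s sS f; elim/SHom_ind=> T t tS g /=.
by rewrite Stensor_Sclass !Srestr_Sclass Stensor_Sclass erase_shuffle.
Qed.

(** * Tensor-restriction *)

Lemma Stensor_restricts A B S (s : Hom S I) (sS : is_subunit s)
    (f : Hom (A ⊗ S) B) :
  @tensor_restricts (S_monoidal C) A B (Sclass sS f) S (Sembed s).
Proof.
have [k kK] := supported_self sS.
(* The section [k] duplicates [S]: one copy feeds [f], the other is kept as output. *)
exists (Sclass sS ((f ⊗₁ idm S) ∘ (alpha A S S ∘ (idm A ⊗₁ k)))).
rewrite /= Sembed_tensor Sembed_comp Sembed_compl -eraseE compA -erase_nat.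
congr Sclass; rewrite -compA (comp_eql (erase_tensor _ _ _)) -tensor_compr kK.
by rewrite tensor1 idr.
Qed.

Lemma Stensor_restricts_erase A B S T (s : Hom S I) (sS : is_subunit s)
    (f : Hom (A ⊗ S) B) (t : Hom T I) :
  @tensor_restricts (S_monoidal C) A B (Sclass sS f) T (Sembed t) ->
  exists h : Hom (A ⊗ S) (B ⊗ T), f = erase B t ∘ h.
Proof.
move=> [y]; elim/(@SHom_ind A (B ⊗ T)): y => U u uS h /=.
rewrite Sembed_tensor Sembed_comp Sembed_compl -eraseE => /esym e.
have [_ [m um]] := Sclass_eq_le e.
exists (h ∘ (idm A ⊗₁ m)); rewrite compA; exact: Sclass_eqE e um.
Qed.

(** The witness is a section of an embedded map, so [Sembed_of_split] brings it back to [C]. *)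
Lemma Stensor_restricts_id X S (s : Hom S I) :
  @tensor_restricts (S_monoidal C) X X (Sembed (idm X)) S (Sembed s) <->
  supported X s.
Proof.
split=> [[y /=]|[h hK]].
  rewrite Sembed_tensor Sembed_comp -eraseE => /esym /[dup].
  case/Sembed_of_split=> h ->; rewrite Sembed_comp => /Sembed_inj hK.
  by exists h.
by exists (Sembed h); rewrite /= Sembed_tensor !Sembed_comp -eraseE hK.
Qed.

Lemma Stensor_total_supported X Y S (s : Hom S I) (sS : is_subunit s)
    (f : Hom (X ⊗ S) Y) :
  @is_tensor_total (S_monoidal C) X Y (Sclass sS f) -> supported X s.
Proof.
move=> ft; apply/Stensor_restricts_id/ft; last exact: Stensor_restricts.
by apply/S_subunitP; exists s.
Qed.

(** * Tensor-restriction points *)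

Lemma Spoint_of_iso X S (s : Hom S I) (sS : is_subunit s)
    (f : Hom (I ⊗ S) X) :
  is_iso f -> @is_tensor_restriction_point (S_construction C) X (Sclass sS f).
Proof.
move=> fI; have [f' [f'f ff']] := fI.
have g_iso : is_iso (lam S ∘ f').
  by apply: iso_comp; [exact: lamI|exists f].
(* [g] is [s] transported along [X ≅ I ⊗ S ≅ S]; the restriction inverse is [g] cut down to [s]. *)
have [g gE gf] : exists2 g, g = s ∘ (lam S ∘ f') & g ∘ f = erase I s.
  exists (s ∘ (lam S ∘ f')) => //.
  by rewrite -!compA f'f idr erase_unit.
have supX : supported X s by apply: (supported_iso fI); exact: supportedA.
exists (Sclass sS (g ∘ erase X s)); split; first split=> /=.
- rewrite Scomp_Sclass Srestr_Sclass; apply: esym.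
  apply: (Sclass_eq (m := erase S s)).
  + exact: sub_le_meet (sub_le_refl s) (sub_le_refl s).
  + exact: meet_erase.
  rewrite -[g ∘ _ ∘ _]compA -erase_nat compA gf -compA erase_tensor.
  by [].
- rewrite Scomp_Sclass Srestr_Sclass; apply: esym.
  apply: (Sclass_eq (m := erase S s)).
  + exact: sub_le_meet (sub_le_refl s) (sub_le_refl s).
  + exact: meet_erase.
  apply: (supported_cancel (s := s) (e := g)).
  + by apply: supported_tensor; exact: supportedA.
  + rewrite gE; apply: local_iso_comp.
      exact: local_iso_sub (sub_le_refl s).
    exact: local_iso_of_iso.
  rewrite -!compA (comp_eql gf) (comp_eql (esym (erase_nat _ _))) -compA.
  by rewrite erase_tensor -compA.
(* Tensor-totality: a factorisation of [g ∘ erase X s] through [t] yields [s] below [t] along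
   [X ≅ S], and [X] is supported in [s]. *)
move=> T x /S_subunitP[t tS ->].
move=> /(@Stensor_restricts_erase X I S T)[h gh].
apply/Stensor_restricts_id/(supported_le _ supX).
have [k kK] := supX; have [w [_ wK]] := g_iso.
exists (@lam C T ∘ (h ∘ (k ∘ w))).
by rewrite compA -erase_unit !compA -gh -(compA k) kK idr gE -compA wK idr.
Qed.

(** The two equations of a restriction inverse bound the subunits of [d] and [d'] by each other, so
    both live over [s]. Tensor-totality then supports [X] in [s], which turns a map out of [X ⊗ S]
    into one out of [X]. *)
Lemma Spoint_exists_iso X (d : SHom I X) :
  @is_tensor_restriction_point (S_construction C) X d ->
  exists S (s : Hom S I) (sS : is_subunit s) (f : Hom (I ⊗ S) X),
    is_iso f /\ d = Sclass sS f.
Proof.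
elim/SHom_ind: d => S s sS f [d'].
elim/(@SHom_ind X I): d' => T t tS g0 [[/= gf fg] g0t].
exists S, s, sS, f; split=> //.
have st : sub_le s t.
  move: gf; rewrite Scomp_Sclass Srestr_Sclass => /Sclass_eq_le[_].
  by move=> le_s; exact: sub_le_trans le_s (meet_le_r _ _).
have ts : sub_le t s.
  move: fg; rewrite Scomp_Sclass Srestr_Sclass => /Sclass_eq_le[_].
  by move=> le_t; exact: sub_le_trans le_t (meet_le_r _ _).
have [m _ gE] := Sclass_sub tS sS g0 ts st.
move: (g0 ∘ _) gE gf fg g0t => g {m} -> gf fg gt {g0 t tS st ts T}.
have [h hK] := Stensor_total_supported gt; have [k kK] := supported_self sS.
have fgE : f ∘ ((g ⊗₁ idm S) ∘ alpha X S S) = erase X s ∘ (idm X ⊗₁ erase S s).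
  rewrite compA; move: fg; rewrite Scomp_Sclass Srestr_Sclass => /esym e.
  exact: Sclass_eqE e (meet_erase s s).
(* [f] is a map of coalgebras: the two sides have the same erasure. *)
have hf : h ∘ f = (f ⊗₁ idm S) ∘ (alpha I S S ∘ (idm I ⊗₁ k)).
  apply: (supported_cancel (s := s) (e := erase X s)).
  - exact: supportedA.
  - exact: local_iso_erase (sub_le_refl s).
  rewrite compA hK idl compA -erase_nat -compA (comp_eql (erase_tensor _ _ _)).
  by rewrite -tensor_compr kK tensor1 idr.
(* The inverse of [f] extracts a copy of [S] by [h], duplicates it by [k], and spends one copy on
   [g]. *)
exists ((g ⊗₁ idm S) ∘ (alpha X S S ∘ ((idm X ⊗₁ k) ∘ h))); split; last first.
  rewrite !compA -(compA (alpha X S S)) fgE -!compA (compA h).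
  by rewrite -tensor_compr kK tensor1 idl hK.
apply: (supported_cancel (s := s) (e := erase I s)).
- exact: supportedA.
- exact: local_iso_erase (sub_le_refl s).
have gfE : g ∘ ((f ⊗₁ idm S) ∘ alpha I S S) = erase I s ∘ (idm I ⊗₁ erase S s).
  rewrite compA; move: gf; rewrite Scomp_Sclass Srestr_Sclass => /esym e.
  exact: Sclass_eqE e (meet_erase s s).
rewrite idr compA (comp_eql (esym (erase_nat s g))) -!compA hf.
rewrite (comp_eql (erase_tensor _ _ _)) (comp_eql (esym (tensor_compr _ _ _))).
rewrite kK tensor1 idl [_ ∘ (alpha _ _ _ ∘ _)]compA (comp_eql gfE) -compA.
by rewrite -tensor_compr kK tensor1 idr.
Qed.

(** * Verification of the axioms *)

Lemma Spoint_sub X S T (s : Hom S I) (t : Hom T I) (sS : is_subunit s)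
    (tS : is_subunit t) (f : Hom (I ⊗ T) X) :
  sub_le s t -> sub_le t s -> is_iso f ->
  exists2 g : Hom (I ⊗ S) X, is_iso g & Sclass tS f = Sclass sS g.
Proof.
move=> st ts fI; have [m mI ->] := Sclass_sub tS sS f ts st.
exists (f ∘ (idm I ⊗₁ m)) => //; apply: iso_comp => //.
by apply: iso_tensor => //; exact: idm_iso.
Qed.

(** The class of [lam S] over [s] is the point that (TR1) and (TR2) attach to [s]. *)
Lemma Scomp_embed_point S (s : Hom S I) (sS : is_subunit s) :
  Scomp (Sembed s) (Sclass sS (lam S)) = Sclass sS (erase I s).
Proof. by rewrite Sembed_compl erase_unit. Qed.

(** Multiplication by a scalar keeps its subunit and changes only the object, so in (TR3) the scalar
    can be read off from the idempotent. *)
Lemma Sscalar_mul X S (s : Hom S I) (sS : is_subunit s) :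
  @scalar_mul (S_monoidal C) (Sclass sS (erase I s)) X =
  Sclass sS (erase X s).
Proof.
rewrite /scalar_mul /= [Sembed (idm X)]SembedE idl -erase_id Stensor_Sclass.
rewrite erase_shuffle Sembed_compl Sembed_compr.
apply: esym; apply: (Sclass_eq_iso (m := rho S)).
- exact: rhoI.
- exact: meet_unitr.
rewrite -compA -erase_nat compA (proj2 (lam_iso mon X)) idl.
by rewrite meet_unitr erase_comp.
Qed.

Lemma Sidempotent_exists X (f : SHom X X) :
  Srestr f = f -> exists S (s : Hom S I) (sS : is_subunit s),
    f = Sclass sS (erase X s).
Proof.
elim/SHom_ind: f => S s sS f <-; rewrite Srestr_Sclass.
by exists S, s, sS.
Qed.

Lemma S_TR3 X (f : SHom X X) : Srestr f = f ->
  exists! e : SHom I I, Srestr e = e /\ f = @scalar_mul (S_monoidal C) e X.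
Proof.
move=> /Sidempotent_exists[S [s [sS ->]]].
exists (Sclass sS (erase I s)); split.
  by rewrite Srestr_Sclass Sscalar_mul.
move=> e [/Sidempotent_exists[T [t [tS ->]]]].
by rewrite Sscalar_mul => /Sclass_eq_le[st ts]; exact: Serase_eq.
Qed.

(** Tensor-totality makes [erase X s] invertible, so the total part is [f] precomposed with its
    inverse. A restriction-total competitor has an invertible subunit and hence also comes from
    [C]. *)
Lemma S_TR4 X Y (f : SHom X Y) :
  @is_tensor_total (S_monoidal C) X Y f ->
  exists! f' : SHom X Y, Srestr f' = Sembed (idm X) /\ f = Scomp f' (Srestr f).
Proof.
elim/SHom_ind: f => S s sS f /Stensor_total_supported sX.
have [h [hK Kh]] := erase_iso sS sX; rewrite Srestr_Sclass.
exists (Sembed (f ∘ h)); split.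
  split; last by rewrite Sembed_compl -compA hK idr.
  by rewrite [LHS]Srestr_Sclass erase_id SembedE idl.
elim/SHom_ind=> T t tS g []; rewrite Srestr_Sclass => /Sclass_total tI.
have [k ->] := Sclass_embed tS g tI.
by rewrite Sembed_compl => /Sclass_inj ->; rewrite -compA Kh idr.
Qed.

Lemma S_TR5 X (d : SHom I X) S (s : Hom S I) (f : SHom I S) (g : SHom X I) :
  @is_tensor_restriction_point (S_construction C) X d -> is_subunit s ->
  Scomp (Sembed s) f = Scomp g d ->
  exists m : SHom X S, f = Scomp m d /\ g = Scomp (Sembed s) m.
Proof.
move=> /Spoint_exists_iso[U [u [uS [p [pI ->]]]]] sS.
elim/SHom_ind: f => V v vS f; elim/SHom_ind: g => W w wS g.
move=> e; have [vw wv] : sub_le v (meet u w) /\ sub_le (meet u w) v.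
  by move: e; rewrite Sembed_compl Scomp_Sclass => /Sclass_eq_le.
have [m _ fE] := Sclass_sub vS (meet_subunit uS wS) f vw wv.
move: (f ∘ _) fE e => f' -> {m vw wv}.
rewrite Sembed_compl Scomp_Sclass => /Sclass_inj; rewrite -compA => sf'.
have [q [qK Kq]] : is_iso ((p ⊗₁ idm W) ∘ alpha I U W).
  apply: iso_comp; last exact: alphaI.
  by apply: iso_tensor => //; exact: idm_iso.
(* [m] carries the subunit [w] of [g]; its map solves [f = m ∘ d], with [q] undoing [p ⊗ W]. *)
exists (Sclass wS (f' ∘ q)).
rewrite Scomp_Sclass Sembed_compl; split; congr Sclass.
  by rewrite -[RHS]compA -[RHS]compA qK idr.
by rewrite compA sf' -compA Kq idr.
Qed.

Lemma S_TR6 X X' (d : SHom I X) (d' : SHom I X') :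
  @is_tensor_restriction_point (S_construction C) X d ->
  @is_tensor_restriction_point (S_construction C) X' d' ->
  @is_tensor_restriction_point (S_construction C) (X ⊗ X')
    (Scomp (Stensor d d') (Sembed (lam_inv I))).
Proof.
move=> /Spoint_exists_iso[S [s [sS [f [fI ->]]]]].
move=> /Spoint_exists_iso[T [t [tS [g [gI ->]]]]].
rewrite Stensor_Sclass Sembed_compr; apply: Spoint_of_iso.
apply: iso_comp.
  by apply: iso_comp (shuffle_iso _ _ _ _); exact: iso_tensor.
by apply: iso_tensor; [exact: lam_invI|exact: idm_iso].
Qed.

(** As [f] is invertible, [h] is determined by [f'], and [k] by [h]; one equivalence thus serves
    both existence and uniqueness in (TR7). *)
Lemma Spoint_comp_scalar X S (s : Hom S I) (sS : is_subunit s)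
    (f f' : Hom (I ⊗ S) X) (k : Hom (I ⊗ S) I) : is_iso f ->
  Sclass sS f' = Scomp (Sclass sS f) (Sclass sS k) <->
  exists2 h, f' = f ∘ h & k = erase I s ∘ h.
Proof.
move=> fI; have [f1 [f1f ff1]] := fI; rewrite Scomp_Sclass.
have fkE : erase I s ∘ ((k ⊗₁ idm S) ∘ alpha I S S) = k ∘ (idm I ⊗₁ erase S s).
  by rewrite compA -erase_nat -compA erase_tensor.
split=> [e|[h -> kE]].
  have := Sclass_eqE e (meet_erase s s).
  move=> /(congr1 (fun x => erase I s ∘ (f1 ∘ x))).
  rewrite -!compA (comp_eql f1f) idl fkE !compA => kE.
  exists (f1 ∘ f'); first by rewrite compA ff1 idl.
  rewrite compA; apply: iso_epic kE.
  by apply: iso_tensor; [exact: idm_iso|exact: erase_self_iso].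
apply: (Sclass_eq (m := erase S s)).
- exact: sub_le_meet (sub_le_refl s) (sub_le_refl s).
- exact: meet_erase.
rewrite -!compA; congr (_ ∘ _).
apply: (supported_cancel (s := s) (e := erase I s)).
- by apply: supported_tensor; exact: supportedA.
- exact: local_iso_erase (sub_le_refl s).
by rewrite fkE kE -compA.
Qed.

Lemma S_TR7 X (d d' : SHom I X) :
  @is_tensor_restriction_point (S_construction C) X d ->
  @is_tensor_restriction_point (S_construction C) X d' ->
  exists! m : SHom I I, Srestr m = Srestr d' /\ d' = Scomp d m.
Proof.
move=> /Spoint_exists_iso[S [s [sS [f [fI ->]]]]].
move=> /Spoint_exists_iso[T [t [tS [g [gI ->]]]]].
have [f' [f'f ff']] := fI; have [g' [g'g gg']] := gI.
have iIS : is_iso (lam S ∘ f') by apply: iso_comp; [exact: lamI|exists f].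
have iIT : is_iso (lam T ∘ g') by apply: iso_comp; [exact: lamI|exists g].
(* [S] and [T] are isomorphic as objects, hence support each other, hence are
   equal as subunits. *)
have st : sub_le s t.
  apply/supported_sub/(supported_iso iIS)/(supported_iso gI).
  exact: supportedA.
have ts : sub_le t s.
  apply/supported_sub/(supported_iso iIT)/(supported_iso fI).
  exact: supportedA.
have [h hI ->] := Spoint_sub sS tS st ts gI.
rewrite Srestr_Sclass; exists (Sclass sS (erase I s ∘ (f' ∘ h))); split.
  rewrite Srestr_Sclass; split=> //; apply/Spoint_comp_scalar => //.
  by exists (f' ∘ h) => //; rewrite compA ff' idl.
(* The condition on the restriction puts a competing scalar over the same [s], where
   [Spoint_comp_scalar] determines it. *)
elim/SHom_ind=> U u uS k []; rewrite Srestr_Sclass => /Sclass_eq_le[us su].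
have [m _ ->] := Sclass_sub uS sS k us su.
move=> /(Spoint_comp_scalar _ _ _ fI)[n -> ->].
by rewrite (compA n) f'f idl.
Qed.

End SConstruction.

Theorem proposition5p8 (C : firm_monoidal_category) :
  is_tensor_restriction_category (S_construction C).
Proof.
split.
- exact: S_is_firm_restriction.
- move=> e /Sidempotent_exists[S [s [sS ->]]].
  exists S, (Sembed s), (Sclass sS (lam S)); split.
  + by apply/S_subunitP; exists s.
  + exact/Spoint_of_iso/lamI.
  + by rewrite -Scomp_embed_point.
- move=> S x /S_subunitP[s sS ->]; exists (Sclass sS (@lam C S)); split.
    exact/Spoint_of_iso/lamI.
  by rewrite /= Scomp_embed_point Srestr_Sclass.
- exact: S_TR3.
- exact: S_TR4.
- move=> X d S x f g dP /S_subunitP[s sS ->]; exact: S_TR5.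
- exact: S_TR6.
- exact: S_TR7.
Qed.
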